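(* Let $\mathcal{I}_2=\mathcal{F}_1\supset\mathcal{F}_2\supset\cdots$ be the filtration of the genus $2$ Torelli group induced by the expanded Jones representation $\varphi$. For each $k\ge2$ the following holds: (1) if $k$ is even, then the $Sp(4,\mathbb{Q})$-module $\mathrm{gr}_k\mathcal{F}_{\mathbb{Q}}=(\mathcal{F}_k/\mathcal{F}_{k+1})\otimes\mathbb{Q}$ contains a submodule isomorphic to $\Gamma_{2,0}$; (2) if $k$ is odd, then the $Sp(4,\mathbb{Q})$-module $\mathrm{gr}_k\mathcal{F}_{\mathbb{Q}}$ contains a submodule isomorphic to $\Gamma_{0,2}$.
   Context: Mapping class group. $\Sigma_2$ is a closed oriented surface of genus $2$, $\mathcal{M}_2$ its (orientation-preserving) mapping class group, $H=H_1(\Sigma_2;\mathbb{Z})$ with the intersection pairing. The natural action on $H$ gives a surjection $\mathcal{M}_2\to Sp(4,\mathbb{Z})$; its kernel is the Torelli group $\mathcal{I}_2$. Let $C_1,\dots,C_5$ be the standard chain of nonseparating simple closed curves on $\Sigma_2$ ($C_i$ and $C_{i+1}$ meet transversally in one point, $C_i\cap C_j=\emptyset$ if $|i-j|\ge 2$), and let $\zeta_i$ be the Dehn twist along $C_i$ (all of the same handedness). $\mathcal{M}_2$ is generated by $\zeta_1,\dots,\zeta_5$. Put $\xi=\zeta_1\zeta_2\zeta_3\zeta_4\zeta_5$; then $\zeta_{i+1}=\xi\zeta_i\xi^{-1}$ for $1\le i\le 4$, so $\zeta_1,\xi$ generate $\mathcal{M}_2$. Jones representation. $\rho:\mathcal{M}_2\to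 GL(5,\mathbb{Z}[t,t^{-1}])$ is the homomorphism determined by $$\rho(\zeta_1)=\begin{pmatrix}-t^{-2}&0&0&0&t^3\\0&-t^{-2}&t^{-2}&0&0\\0&0&t^3&0&0\\0&0&t^{-2}&-t^{-2}&0\\0&0&0&0&t^3\end{pmatrix},\quad \rho(\xi)=\begin{pmatrix}0&0&1&0&0\\0&0&0&0&1\\1&0&0&0&0\\0&1&0&0&0\\0&0&0&1&0\end{pmatrix}.$$ Expansion and filtration. Let $R=M(5,\mathbb{Q}[[h]])$ (the $5\times5$ matrices over $\mathbb{Q}[[h]]$), and let $\varphi:\mathcal{M}_2\to R^\times$ be obtained from $\rho$ by substituting $t=-e^h$ and expanding powers of $e^h$ in Taylor series. For $k\ge0$ let $R[k]=h^kR$, $\mathrm{gr}_kR=R[k]/R[k+1]$, and let $\varphi^{(k)}:\mathcal{M}_2\to(R/R[k+1])^\times$ be $\varphi$ followed by the projection. For $k\ge1$ let $\mathcal{F}_k=\mathcal{I}_2\cap\ker\varphi^{(k-1)}$. One has $\mathcal{F}_1=\mathcal{I}_2$. Put $\mathrm{gr}_k\mathcal{F}=\mathcal{F}_k/\mathcal{F}_{k+1}$ (a free abelian group of finite rank) and $\mathrm{gr}_k\mathcal{F}_{\mathbb{Q}}=\mathrm{gr}_k\mathcal{F}\otimes\mathbb{Q}$. Module structure. Conjugation by $\mathcal{M}_2$ on $\mathcal{I}_2$ preserves the filtration and induces an action of $Sp(4,\mathbb{Z})=\mathcal{M}_2/\mathcal{I}_2$ on $\mathrm{gr}_k\mathcal{F}$.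 The map $\psi\mapsto\varphi(\psi)-1$ induces an $Sp(4,\mathbb{Z})$-equivariant embedding $\mathrm{gr}_k\mathcal{F}\hookrightarrow\mathrm{gr}_kR$, where $\mathcal{M}_2$ acts on $\mathrm{gr}_kR$ by conjugation by $\varphi^{(0)}$ (this factors through $Sp(4,\mathbb{Z})$ and extends to a rational $Sp(4,\mathbb{Q})$-module structure). The $Sp(4,\mathbb{Q})$-module structure on $\mathrm{gr}_k\mathcal{F}_{\mathbb{Q}}$ is the rational (algebraic) one extending the $Sp(4,\mathbb{Z})$-action, i.e. that of an $Sp(4,\mathbb{Q})$-submodule of $\mathrm{gr}_kR$. Irreducible modules. $L_1,L_2$ denote the standard weights of the diagonal Cartan subalgebra of $\mathfrak{sp}(4,\mathbb{C})$ ($L_i(\mathrm{diag}(a_1,a_2,-a_1,-a_2))=a_i$), and $\Gamma_{a,b}$ is the irreducible rational representation of $Sp(4,\mathbb{Q})$ with highest weight $aL_1+b(L_1+L_2)$. *)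

(* Defs.v *)
From HB Require Import structures.
From mathcomp Require Import all_boot all_order all_algebra.
From mathcomp Require Import boolp.
From mathcomp Require Import ring.

Set Implicit Arguments.
Unset Strict Implicit.
Unset Printing Implicit Defensive.

Import GRing.Theory.
Local Open Scope ring_scope.
Local Open Scope quotient_scope.

Local Notation "p %:F" := (@FracField.tofrac {poly int} p).

(** * The ring Z[t,t^-1], as the subring of Z(t) of the elements p / t^n *)

Definition is_laurent : {pred {fraction {poly int}}} :=
  fun x => `[< exists (p : {poly int}) (n : nat), x = p%:F / ('X^n)%:F >].

Lemma is_laurentP x :
  reflect (exists (p : {poly int}) (n : nat), x = p%:F / ('X^n)%:F)
          (x \in is_laurent).
Proof. exact: asboolP. Qed.

Lemma tofrac_Xn_neq0 n : ('X^n : {poly int})%:F != 0.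
Proof. by rewrite tofrac_eq0 monic_neq0 // monicXn. Qed.

Lemma is_laurent_subring : subring_closed is_laurent.
Proof.
split.
- by apply/is_laurentP; exists 1, 0%N; rewrite expr0 divr1.
- move=> _ _ /is_laurentP[p [n ->]] /is_laurentP[q [m ->]]; apply/is_laurentP.
  exists (p * 'X^m - q * 'X^n), (n + m)%N.
  rewrite exprD !(tofracM, tofracB) -mulNr addf_div ?tofrac_Xn_neq0 //.
  by rewrite mulNr.
- move=> _ _ /is_laurentP[p [n ->]] /is_laurentP[q [m ->]]; apply/is_laurentP.
  by exists (p * q), (n + m)%N; rewrite exprD !tofracM invfM mulrACA.
Qed.

HB.instance Definition _ :=
  GRing.isSubringClosed.Build {fraction {poly int}} is_laurent
    is_laurent_subring.

Record laurent := Laurent {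
  laurent_val :> {fraction {poly int}};
  laurent_valP : laurent_val \in is_laurent }.

HB.instance Definition _ := [isSub for laurent_val].
HB.instance Definition _ := [Choice of laurent by <:].
HB.instance Definition _ := [SubChoice_isSubComNzRing of laurent by <:].

Definition laurent_unit : {pred laurent} :=
  fun x => `[< exists y : laurent, y * x = 1 >].
Definition laurent_inv (x : laurent) : laurent :=
  if pselect (exists y : laurent, y * x = 1) is left e then sval (cid e) else x.

Lemma laurent_mulVx : {in laurent_unit, left_inverse 1 laurent_inv *%R}.
Proof.
move=> x /asboolP ux; rewrite /laurent_inv; case: pselect => // e.
exact: svalP (cid e).
Qed.

Lemma laurent_unitPl (x y : laurent) : y * x = 1 -> laurent_unit x.
Proof. by move=> yx; apply/asboolP; exists y. Qed.

Lemma laurent_invr_out : {in [predC laurent_unit], laurent_inv =1 id}.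
Proof.
move=> x; rewrite inE => /asboolPn nux.
by rewrite /laurent_inv; case: pselect.
Qed.

HB.instance Definition _ := GRing.ComNzRing_hasMulInverse.Build laurent
  laurent_mulVx laurent_unitPl laurent_invr_out.

Lemma laurent_subproof (p : {poly int}) n : p%:F / ('X^n)%:F \in is_laurent.
Proof. by apply/is_laurentP; exists p, n. Qed.

Definition lfrac (p : {poly int}) (n : nat) : laurent :=
  Laurent (laurent_subproof p n).

Definition tL : laurent := lfrac 'X 0.

Lemma tLV : lfrac 1 1 * tL = 1.
Proof.
apply/val_inj; rewrite rmorphM rmorph1 /= expr1 expr0 divr1 mulrC.
by rewrite mul1r divff // -[X in tofrac X]expr1 tofrac_Xn_neq0.
Qed.

Lemma tL_unit : tL \is a GRing.unit.
Proof. exact: laurent_unitPl tLV. Qed.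

Lemma tLVE : tL^-1 = lfrac 1 1.
Proof. by apply: (mulIr tL_unit); rewrite mulVr ?tL_unit ?tLV. Qed.

(** Q[[h]] *)
Definition fps : Type := nat -> rat.

HB.instance Definition _ := gen_eqMixin fps.
HB.instance Definition _ := gen_choiceMixin fps.

Definition fps_zero : fps := fun=> 0.
Definition fps_opp (f : fps) : fps := fun n => - f n.
Definition fps_add (f g : fps) : fps := fun n => f n + g n.
Definition fps_one : fps := fun n => (n == 0%N)%:R.
Definition fps_mul (f g : fps) : fps :=
  fun n => \sum_(i < n.+1) f i * g (n - i)%N.

Lemma fps_addA : associative fps_add.
Proof. by move=> f g k; apply/funext => n; apply: addrA. Qed.
Lemma fps_addC : commutative fps_add.
Proof. by move=> f g; apply/funext => n; apply: addrC. Qed.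
Lemma fps_add0 : left_id fps_zero fps_add.
Proof. by move=> f; apply/funext => n; apply: add0r. Qed.
Lemma fps_addN : left_inverse fps_zero fps_opp fps_add.
Proof. by move=> f; apply/funext => n; apply: addNr. Qed.

HB.instance Definition _ :=
  GRing.isZmodule.Build fps fps_addA fps_addC fps_add0 fps_addN.

Definition fps_trunc (n : nat) (f : fps) : {poly rat} := \poly_(i < n.+1) f i.

Lemma fps_truncE n (f : fps) i : (i <= n)%N -> (fps_trunc n f)`_i = f i.
Proof. by move=> lein; rewrite coef_poly ltnS lein. Qed.

Lemma fps_mulE n (f g : fps) i : (i <= n)%N ->
  fps_mul f g i = (fps_trunc n f * fps_trunc n g)`_i.
Proof.
move=> lein; rewrite coefM; apply: eq_bigr => j _.
by rewrite !fps_truncE // (leq_trans _ lein) ?leq_subr // -ltnS.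
Qed.

Lemma fps_mulC : commutative fps_mul.
Proof.
by move=> f g; apply/funext => n; rewrite !(@fps_mulE n) // mulrC.
Qed.

Lemma fps_mulA : associative fps_mul.
Proof.
move=> f g k; apply/funext => n.
transitivity ((fps_trunc n f * (fps_trunc n g * fps_trunc n k))`_n).
  rewrite coefM; apply: eq_bigr => j _.
  by rewrite fps_truncE -1?ltnS // (@fps_mulE n) // leq_subr.
rewrite mulrA coefM; apply: eq_bigr => j _.
by rewrite (@fps_mulE n) -1?ltnS // fps_truncE // leq_subr.
Qed.

Lemma fps_mul1 : left_id fps_one fps_mul.
Proof.
move=> f; apply/funext => n; rewrite /fps_mul big_ord_recl subn0 mul1r.
by rewrite big1 ?addr0 // => i _; rewrite mul0r.
Qed.

Lemma fps_mulDl : left_distributive fps_mul fps_add.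
Proof.
move=> f g k; apply/funext => n; rewrite /fps_mul /fps_add -big_split.
by apply: eq_bigr => i _; rewrite mulrDl.
Qed.

Lemma fps_1neq0 : fps_one != fps_zero.
Proof. by apply/eqP => /(congr1 (fun f : fps => f 0%N)). Qed.

HB.instance Definition _ := GRing.Zmodule_isComNzRing.Build fps
  fps_mulA fps_mulC fps_mul1 fps_mulDl fps_1neq0.

Definition hvar : fps := fun n => (n == 1%N)%:R.

(** [expfps c] is the Taylor expansion of e^(ch). *)
Definition expfps (c : rat) : fps := fun n => c ^+ n / (n`!)%:R.

Lemma expfpsD c d : expfps c * expfps d = expfps (c + d).
Proof.
apply/funext => n; rewrite /expfps addrC exprDn mulr_suml.
apply: eq_bigr => i _; rewrite -mulr_natr.
have nz k : (k`!)%:R != 0 :> rat by rewrite Num.Theory.pnatr_eq0 -lt0n fact_gt0.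
have lein : (i <= n)%N by rewrite -ltnS.
rewrite -(bin_fact lein) !natrM; field.
by rewrite !nz Num.Theory.pnatr_eq0 -lt0n bin_gt0 lein.
Qed.

Lemma expfps0 : expfps 0 = 1.
Proof.
by apply/funext => -[|n]; rewrite /expfps ?expr0 ?divr1 // exprS !mul0r.
Qed.

Definition tval : fps := - expfps 1.
Definition tvalV : fps := - expfps (- 1).

Lemma tvalK : tval * tvalV = 1.
Proof. by rewrite /tval /tvalV mulrNN expfpsD subrr expfps0. Qed.

Definition fps_eval (p : {poly int}) : fps := (map_poly intr p).[tval].

Definition laurent_repr (x : laurent) :
    {pn : {poly int} * nat | val x = pn.1%:F / ('X^(pn.2))%:F}.
Proof.
apply: cid; have /is_laurentP[p [n e]] := laurent_valP x.
by exists (p, n).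
Defined.

Definition subst_exp (x : laurent) : fps :=
  let pn := sval (laurent_repr x) in fps_eval pn.1 * tvalV ^+ pn.2.

Lemma fps_evalXn (p : {poly int}) n : fps_eval (p * 'X^n) = fps_eval p * tval ^+ n.
Proof. by rewrite /fps_eval rmorphM /= map_polyXn hornerM hornerXn. Qed.

(** The value does not depend on the way x is written as p / t^n. *)
Lemma subst_exp_frac (x : laurent) (p : {poly int}) n :
  val x = p%:F / ('X^n)%:F -> subst_exp x = fps_eval p * tvalV ^+ n.
Proof.
rewrite /subst_exp; case: laurent_repr => -[q m] /= -> /eqP.
rewrite eqr_div ?tofrac_Xn_neq0 // -!tofracM tofrac_eq => /eqP epq.
have inv k : tval ^+ k * tvalV ^+ k = 1 by rewrite -exprMn tvalK expr1n.
move: (congr1 fps_eval epq); rewrite !fps_evalXn => e.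
rewrite -[RHS]mulr1 -(inv m).
have -> : fps_eval p * tvalV ^+ n * (tval ^+ m * tvalV ^+ m)
        = fps_eval p * tval ^+ m * (tvalV ^+ n * tvalV ^+ m) by ring.
rewrite -e -[LHS]mulr1 -(inv n); ring.
Qed.

Lemma subst_exp_is_zmod : zmod_morphism subst_exp.
Proof.
move=> x y; have [[p n] /= ex] := laurent_repr x.
have [[q m] /= ey] := laurent_repr y.
rewrite (subst_exp_frac ex) (subst_exp_frac ey).
rewrite (@subst_exp_frac _ (p * 'X^m - q * 'X^n) (n + m)); last first.
  rewrite rmorphB /= ex ey exprD !(tofracM, tofracB) -mulNr.
  by rewrite addf_div ?tofrac_Xn_neq0 // mulNr.
have inv k : tval ^+ k * tvalV ^+ k = 1 by rewrite -exprMn tvalK expr1n.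
have -> : fps_eval (p * 'X^m - q * 'X^n)
        = fps_eval (p * 'X^m) - fps_eval (q * 'X^n).
  by rewrite /fps_eval rmorphB hornerD hornerN.
rewrite !fps_evalXn exprD mulrBl; congr (_ - _).
  by rewrite -[RHS]mulr1 -(inv m); ring.
by rewrite -[RHS]mulr1 -(inv n); ring.
Qed.

Lemma subst_exp_is_monoid : monoid_morphism subst_exp.
Proof.
split=> [|x y].
  rewrite (@subst_exp_frac _ 1 0) ?expr0 ?divr1 ?rmorph1 ?mulr1 //.
  by rewrite /fps_eval rmorph1 hornerC.
have [[p n] /= ex] := laurent_repr x; have [[q m] /= ey] := laurent_repr y.
rewrite (subst_exp_frac ex) (subst_exp_frac ey).
rewrite (@subst_exp_frac _ (p * q) (n + m)); last first.
  by rewrite rmorphM /= ex ey exprD !tofracM invfM mulrACA.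
by rewrite /fps_eval rmorphM hornerM exprD mulrACA.
Qed.

HB.instance Definition _ :=
  GRing.isZmodMorphism.Build laurent fps subst_exp subst_exp_is_zmod.
HB.instance Definition _ :=
  GRing.isMonoidMorphism.Build laurent fps subst_exp subst_exp_is_monoid.

Lemma subst_exp_tL : subst_exp tL = - expfps 1.
Proof.
rewrite (@subst_exp_frac _ 'X 0) ?mulr1 /fps_eval ?map_polyX ?hornerX //.
Qed.


(** * The mapping class group of a closed oriented surface of genus 2

    The group is given by the Birman-Hilden presentation on the Dehn twists
    along the standard chain of curves.  The generator usually called zeta_i
    (1 <= i <= 5) is numbered i - 1 here; in a word, [(i, true)] stands for
    that generator and [(i, false)] for its inverse. *)

Definition letter : Type := 'I_5 * bool.
Definition word : Type := seq letter.

Definition wz (i : 'I_5) : word := [:: (i, true)].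
Definition winv (w : word) : word := rev [seq (l.1, ~~ l.2) | l <- w].
Definition chain5 : seq 'I_5 :=
  [:: @Ordinal 5 0 isT; @Ordinal 5 1 isT; @Ordinal 5 2 isT; @Ordinal 5 3 isT;
      @Ordinal 5 4 isT].
Definition wchain : word := [seq (i, true) | i <- chain5].
Definition whyp : word := wchain ++ rev wchain.

Inductive mcg_eq : word -> word -> Prop :=
| mcg_refl u : mcg_eq u u
| mcg_sym u v : mcg_eq u v -> mcg_eq v u
| mcg_trans u v w : mcg_eq u v -> mcg_eq v w -> mcg_eq u w
| mcg_cat u u' v v' : mcg_eq u u' -> mcg_eq v v' -> mcg_eq (u ++ v) (u' ++ v')
| mcg_cancel l : mcg_eq ([:: l] ++ winv [:: l]) [::]
| mcg_commute (i j : 'I_5) : (i.+1 < j)%N ->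
    mcg_eq (wz i ++ wz j) (wz j ++ wz i)
| mcg_braid (i j : 'I_5) : j = i.+1 :> nat ->
    mcg_eq (wz i ++ wz j ++ wz i) (wz j ++ wz i ++ wz j)
| mcg_chain : mcg_eq (flatten (nseq 6 wchain)) [::]
| mcg_hyp : mcg_eq (whyp ++ whyp) [::]
| mcg_hyp_central i : mcg_eq (whyp ++ wz i) (wz i ++ whyp).

Lemma mcg_cancelV l : mcg_eq (winv [:: l] ++ [:: l]) [::].
Proof.
case: l => i b; have := mcg_cancel (i, ~~ b).
by rewrite /winv /rev /= negbK.
Qed.

Lemma winv_cat u v : winv (u ++ v) = winv v ++ winv u.
Proof. by rewrite /winv map_cat rev_cat. Qed.

Lemma winvK : involutive winv.
Proof.
move=> w; rewrite /winv map_rev revK -map_comp -[RHS]map_id.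
by apply: eq_map => -[i b] /=; rewrite negbK.
Qed.

Lemma mcg_mulV w : mcg_eq (w ++ winv w) [::].
Proof.
elim/last_ind: w => [|w l IH]; first exact: mcg_refl.
rewrite -cats1 winv_cat -catA (catA [:: l]).
apply: mcg_trans IH; apply: mcg_cat; first exact: mcg_refl.
rewrite -[X in mcg_eq _ X]cat0s; apply: mcg_cat; first exact: mcg_cancel.
exact: mcg_refl.
Qed.

Lemma mcg_Vmul w : mcg_eq (winv w ++ w) [::].
Proof. by have := mcg_mulV (winv w); rewrite winvK. Qed.

Lemma mcg_inv u v : mcg_eq u v -> mcg_eq (winv u) (winv v).
Proof.
move=> uv; apply: (@mcg_trans _ (winv u ++ (v ++ winv v))).
  rewrite -[X in mcg_eq X _]cats0; apply: mcg_cat; first exact: mcg_refl.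
  exact/mcg_sym/mcg_mulV.
rewrite catA -[X in mcg_eq _ X]cat0s; apply: mcg_cat; last exact: mcg_refl.
apply: mcg_trans (mcg_Vmul u); apply: mcg_cat; first exact: mcg_refl.
exact: mcg_sym.
Qed.

Definition mcg_eqb : rel word := fun u v => `[< mcg_eq u v >].

Lemma mcg_eqb_refl : reflexive mcg_eqb.
Proof. by move=> u; apply/asboolP/mcg_refl. Qed.
Lemma mcg_eqb_sym : symmetric mcg_eqb.
Proof. by move=> u v; apply/asboolP/asboolP => /mcg_sym. Qed.
Lemma mcg_eqb_trans : transitive mcg_eqb.
Proof.
by move=> v u w /asboolP uv /asboolP vw; apply/asboolP/(mcg_trans uv vw).
Qed.

Canonical mcg_equiv := EquivRel mcg_eqb mcg_eqb_refl mcg_eqb_sym mcg_eqb_trans.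

Definition mcg : Type := {eq_quot mcg_equiv}.
HB.instance Definition _ := Choice.on mcg.
HB.instance Definition _ := EqQuotient.on mcg.

Definition mcg_of (w : word) : mcg := \pi_mcg w.

Lemma mcg_ofP u v : mcg_of u = mcg_of v <-> mcg_eq u v.
Proof.
split=> [/eqquotP/asboolP //|uv]; apply/eqquotP; exact/asboolP.
Qed.

Lemma mcg_repr (x : mcg) : mcg_of (repr x) = x.
Proof. exact: reprK. Qed.

Lemma mcg_reprE w : mcg_eq (repr (mcg_of w)) w.
Proof. by apply/mcg_ofP; rewrite mcg_repr. Qed.

Definition mcg_mul (x y : mcg) : mcg := mcg_of (repr x ++ repr y).
Definition mcg_one : mcg := mcg_of [::].
Definition mcg_opp (x : mcg) : mcg := mcg_of (winv (repr x)).

Lemma mcg_mulE u v : mcg_mul (mcg_of u) (mcg_of v) = mcg_of (u ++ v).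
Proof. by apply/mcg_ofP/mcg_cat; apply: mcg_reprE. Qed.
Lemma mcg_invE u : mcg_opp (mcg_of u) = mcg_of (winv u).
Proof. by apply/mcg_ofP/mcg_inv; apply: mcg_reprE. Qed.

Lemma mcg_mulA : associative mcg_mul.
Proof.
move=> x y z; rewrite -(mcg_repr x) -(mcg_repr y) -(mcg_repr z).
by rewrite !mcg_mulE catA.
Qed.
Lemma mcg_mul1 : left_id mcg_one mcg_mul.
Proof. by move=> x; rewrite -(mcg_repr x) mcg_mulE. Qed.
Lemma mcg_mulr1 : right_id mcg_one mcg_mul.
Proof. by move=> x; rewrite -(mcg_repr x) mcg_mulE cats0. Qed.
Lemma mcg_mulVx : left_inverse mcg_one mcg_opp mcg_mul.
Proof.
move=> x; rewrite -(mcg_repr x) mcg_invE mcg_mulE; exact/mcg_ofP/mcg_Vmul.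
Qed.
Lemma mcg_mulxV : right_inverse mcg_one mcg_opp mcg_mul.
Proof.
move=> x; rewrite -(mcg_repr x) mcg_invE mcg_mulE; exact/mcg_ofP/mcg_mulV.
Qed.

HB.instance Definition _ := isGroup.Build mcg
  mcg_mulA mcg_mul1 mcg_mulr1 mcg_mulVx mcg_mulxV.

Definition zeta (i : 'I_5) : mcg := mcg_of (wz i).
Definition xi : mcg := (\prod_(i <- chain5) zeta i)%g.

Lemma mcg_ofM u v : mcg_of (u ++ v) = (mcg_of u * mcg_of v)%g.
Proof. exact/esym/mcg_mulE. Qed.

Lemma mcg_of_chain : mcg_of wchain = xi.
Proof.
rewrite /wchain /xi; elim: chain5 => [|i s IH]; first by rewrite big_nil.
by rewrite big_cons -IH -mcg_ofM.
Qed.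

(** Evaluation in a ring of the representation sending [zeta i] to [g i]. *)
Definition weval (A : unitRingType) (g : 'I_5 -> A) (w : word) : A :=
  \prod_(l <- w) (if l.2 then g l.1 else (g l.1)^-1).

Section Weval.
Variables (A : unitRingType) (g : 'I_5 -> A).

Lemma weval_cat u v : weval g (u ++ v) = weval g u * weval g v.
Proof. exact: big_cat. Qed.

Lemma weval_z i : weval g (wz i) = g i.
Proof. by rewrite /weval big_seq1. Qed.

Lemma weval_chain : weval g wchain = \prod_(i <- chain5) g i.
Proof. by rewrite /weval big_map. Qed.

Lemma weval_rchain : weval g (rev wchain) = \prod_(i <- rev chain5) g i.
Proof. by rewrite /weval -map_rev big_map. Qed.

Lemma weval_nseq n w : weval g (flatten (nseq n w)) = weval g w ^+ n.
Proof.
elim: n => [|n IH]; first by rewrite /weval big_nil.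
by rewrite [LHS]weval_cat IH exprS.
Qed.

Hypothesis gU : forall i, g i \is a GRing.unit.
Hypothesis gC : forall i j : 'I_5, (i.+1 < j)%N -> g i * g j = g j * g i.
Hypothesis gB : forall i j : 'I_5, j = i.+1 :> nat ->
  g i * g j * g i = g j * g i * g j.
Let x := \prod_(i <- chain5) g i.
Let y := \prod_(i <- rev chain5) g i.
Hypothesis g6 : x ^+ 6 = 1.
Hypothesis g2 : (x * y) ^+ 2 = 1.
Hypothesis gZ : forall i, x * y * g i = g i * (x * y).

Lemma weval_mcg u v : mcg_eq u v -> weval g u = weval g v.
Proof.
elim=> {u v} // [u v w _ -> _ -> //|u u' v v' _ e _ e'|[i b]|i j ij|i j ij|||i].
- by rewrite !weval_cat e e'.
- by rewrite weval_cat /weval !big_seq1 big_nil /=; case: b;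
    rewrite /= (divrr, mulVr) ?gU.
- by rewrite !weval_cat !weval_z gC.
- by rewrite !weval_cat !weval_z !mulrA gB.
- by rewrite weval_nseq weval_chain g6 /weval big_nil.
- rewrite weval_cat -expr2 /whyp weval_cat weval_chain weval_rchain -/x -/y g2.
  by rewrite /weval big_nil.
- by rewrite !(weval_cat, weval_chain, weval_rchain, weval_z) gZ.
Qed.

End Weval.

Definition mx_of_rows (A : pzRingType) n (s : seq (seq A)) : 'M[A]_n :=
  \matrix_(i, j) nth 0 (nth [::] s i) j.

Definition jones_zeta1 : 'M[laurent]_5 := mx_of_rows 5
  [:: [:: - tL ^- 2;        0;        0;        0; tL ^+ 3];
      [::         0; - tL ^- 2;  tL ^- 2;        0;       0];
      [::         0;        0;  tL ^+ 3;        0;       0];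
      [::         0;        0;  tL ^- 2; - tL ^- 2;       0];
      [::         0;        0;        0;        0; tL ^+ 3]].

Definition jones_xi : 'M[laurent]_5 := mx_of_rows 5
  [:: [:: 0; 0; 1; 0; 0];
      [:: 0; 0; 0; 0; 1];
      [:: 1; 0; 0; 0; 0];
      [:: 0; 1; 0; 0; 0];
      [:: 0; 0; 0; 1; 0]].

Definition jones_zeta (i : 'I_5) : 'M[laurent]_5 :=
  jones_xi ^+ i * jones_zeta1 * jones_xi ^- i.

Definition rho (x : mcg) : 'M[laurent]_5 := weval jones_zeta (repr x).

(** * The action on H = Z^4

    The coordinates are those of a symplectic basis a_1, a_2, b_1, b_2, and
    [symJ] is the matrix of the intersection pairing, so that
    (a_i, b_j) = delta_ij.  A Dehn twist along a curve of class c acts by the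
    transvection x |-> x + (c, x) c. *)

Definition symJ (A : pzRingType) : 'M[A]_4 :=
  \matrix_(i, j) ((j == i + 2 :> nat)%N%:R - (i == j + 2 :> nat)%N%:R).

Definition is_symplectic (A : pzRingType) (g : 'M[A]_4) : bool :=
  g^T *m symJ A *m g == symJ A.

(** The classes a_1, b_1, a_2 - a_1, b_2, - a_2 of the curves of the chain;
    consecutive ones have pairing 1, the others have pairing 0. *)
Definition chain_class (i : 'I_5) : 'cV[int]_4 :=
  \col_j nth 0 (nth [::] [:: [:: 1; 0; 0; 0]; [:: 0; 0; 1; 0];
    [:: -1; 1; 0; 0]; [:: 0; 0; 0; 1]; [:: 0; -1; 0; 0]] i) j.

Definition transvection (c : 'cV[int]_4) : 'M[int]_4 :=
  1 + c *m (c^T *m symJ int).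

Definition omega (x : mcg) : 'M[int]_4 :=
  weval (transvection \o chain_class) (repr x).

(** ** Verification of the relations

    With q = t^5, the matrices t^2 (jones_zeta i) have entries in Z[q], and
    the relations are checked on matrices of integer coefficient lists. *)

Fixpoint padd (p r : seq int) : seq int :=
  match p, r with
  | [::], _ => r
  | _, [::] => p
  | a :: p', b :: r' => (a + b) :: padd p' r'
  end.

Definition pscale (a : int) (p : seq int) : seq int := [seq a * b | b <- p].

Definition pmul (p r : seq int) : seq int :=
  foldr (fun a acc => padd (pscale a r) (0 :: acc)) [::] p.

Definition pmx : Type := seq (seq (seq int)).

Definition pcoef (r : pmx) i j : seq int := nth [::] (nth [::] r i) j.

Definition pmx_mul n (r s : pmx) : pmx :=
  mkseq (fun i => mkseq (fun j =>
    foldr (fun k acc => padd (pmul (pcoef r i k) (pcoef s k j)) acc)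
      [::] (iota 0 n)) n) n.

Lemma pcoef_mkseq n (f : nat -> nat -> seq int) (i j : 'I_n) :
  pcoef (mkseq (fun i => mkseq (f i) n) n) i j = f i j.
Proof. by rewrite /pcoef nth_mkseq // nth_mkseq. Qed.

Definition pmx_eq n (r s : pmx) : bool :=
  all (fun i => all (fun j =>
    all (fun a => a == 0) (padd (pcoef r i j) (pscale (-1) (pcoef s i j))))
    (iota 0 n)) (iota 0 n).

Section Pmx.
Variables (A : comNzRingType) (q : A).

Definition pev (p : seq int) : A :=
  foldr (fun a acc => a%:~R + q * acc) 0 p.

Lemma pev_add p r : pev (padd p r) = pev p + pev r.
Proof.
elim: p r => [|a p IH] [|b r] /=; rewrite ?add0r ?addr0 //.
by rewrite IH intrD mulrDr addrACA.
Qed.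

Lemma pev_scale a p : pev (pscale a p) = a%:~R * pev p.
Proof.
elim: p => [|b p IH] /=; rewrite ?mulr0 //.
by rewrite IH intrM mulrDr mulrCA.
Qed.

Lemma pev_mul p r : pev (pmul p r) = pev p * pev r.
Proof.
elim: p => [|a p IH] /=; rewrite ?mul0r //.
by rewrite pev_add pev_scale /= IH add0r mulrDl mulrA.
Qed.

Lemma pev_all0 p : all (fun a => a == 0) p -> pev p = 0.
Proof.
by elim: p => [|a p IH] //= /andP[/eqP-> /IH->]; rewrite mulr0 addr0.
Qed.

Definition pmxev n (r : pmx) : 'M[A]_n := \matrix_(i, j) pev (pcoef r i j).

Lemma pmxevM n r s : pmxev n r *m pmxev n s = pmxev n (pmx_mul n r s).
Proof.
apply/matrixP => i j; rewrite !mxE pcoef_mkseq.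
under eq_bigr do rewrite !mxE -pev_mul.
rewrite -(big_mkord xpredT (fun k => pev (pmul (pcoef r i k) (pcoef s k j)))).
rewrite unlock /index_iota subn0 /=.
by elim: (iota 0 n) => //= k l IH; rewrite pev_add -IH.
Qed.

Lemma pmxev_eq n r s : pmx_eq n r s -> pmxev n r = pmxev n s.
Proof.
move=> /allP rs; apply/matrixP => i j; rewrite !mxE.
have iIn (k : 'I_n) : (k : nat) \in iota 0 n by rewrite mem_iota /= add0n.
have /= /allP rs_i := rs i (iIn i); have /= H := rs_i j (iIn j).
apply/eqP; rewrite -subr_eq0; apply/eqP; move: H => /pev_all0.
by rewrite pev_add pev_scale mulN1r => ->.
Qed.

End Pmx.

Definition jrows (i : nat) : pmx :=
  let o := [::] in let e := [:: 1] in let m := [:: -1] in let q := [:: 0; 1] in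
  nth [::]
  [:: [:: [:: m; o; o; o; q]; [:: o; m; e; o; o]; [:: o; o; q; o; o];
          [:: o; o; e; m; o]; [:: o; o; o; o; q]];
      [:: [:: q; o; o; o; o]; [:: o; q; o; o; o]; [:: o; q; m; o; o];
          [:: e; o; o; m; o]; [:: e; o; o; o; m]];
      [:: [:: m; o; o; q; o]; [:: o; m; e; o; o]; [:: o; o; q; o; o];
          [:: o; o; o; q; o]; [:: o; o; e; o; m]];
      [:: [:: q; o; o; o; o]; [:: e; m; o; o; o]; [:: o; o; m; o; q];
          [:: e; o; o; m; o]; [:: o; o; o; o; q]];
      [:: [:: m; q; o; o; o]; [:: o; q; o; o; o]; [:: o; o; q; o; o];
          [:: o; o; e; m; o]; [:: o; o; e; o; m]]] i.

Definition jxi_rows (e : seq int) : pmx := let o := [::] in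
  [:: [:: o; o; e; o; o]; [:: o; o; o; o; e]; [:: e; o; o; o; o];
      [:: o; e; o; o; o]; [:: o; o; o; e; o]].
Definition jxiV_rows (e : seq int) : pmx := let o := [::] in
  [:: [:: o; o; e; o; o]; [:: o; o; o; e; o]; [:: e; o; o; o; o];
      [:: o; o; o; o; e]; [:: o; e; o; o; o]].
Definition id_rows n : pmx :=
  mkseq (fun i => mkseq (fun j => if i == j then [:: 1] else [::]) n) n.

Local Notation jev := (pmxev (tL ^+ 5) 5).

Lemma jev1 : jev (id_rows 5) = 1.
Proof.
apply/matrixP => i j; rewrite !mxE pcoef_mkseq.
by rewrite -val_eqE; case: ifP; rewrite //= mulr0 addr0.
Qed.

Lemma jevM r s : jev r * jev s = jev (pmx_mul 5 r s).
Proof. exact: pmxevM. Qed.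

Lemma pmxev_q (A : comNzRingType) (q : A) (f : seq int -> pmx) : 
  f = jxi_rows \/ f = jxiV_rows ->
  pmxev q 5 (f [:: 0; 0; 1]) = q ^+ 2 *: pmxev q 5 (f [:: 1]).
Proof.
move=> hf; apply/matrixP => i j; rewrite !mxE.
by case: hf => ->; case: i => -[|[|[|[|[|]]]]] //= _;
  case: j => -[|[|[|[|[|]]]]] //= _;
  rewrite ?(mulr0, addr0, add0r, mulr1).
Qed.

Definition jmx (i : nat) : 'M[laurent]_5 := tL ^- 2 *: jev (jrows i).

Lemma tL_expV n m : tL ^- n * tL ^+ (n + m) = tL ^+ m.
Proof. by rewrite exprD mulKr // unitrX // tL_unit. Qed.

Lemma jones_zeta1E : jones_zeta1 = jmx 0.
Proof.
have e := tL_expV 2 3.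
apply/matrixP => i j; rewrite !mxE.
by case: i => -[|[|[|[|[|]]]]] //= _; case: j => -[|[|[|[|[|]]]]] //= _;
  rewrite ?(mulr0, addr0, add0r, mulr1, mulrN1).
Qed.

Lemma jones_xiE : jones_xi = jev (jxi_rows [:: 1]).
Proof.
apply/matrixP => i j; rewrite !mxE.
by case: i => -[|[|[|[|[|]]]]] //= _; case: j => -[|[|[|[|[|]]]]] //= _;
  rewrite ?(mulr0, addr0, add0r, mulr1, mulrN1).
Qed.

Lemma jones_xiK : jones_xi * jev (jxiV_rows [:: 1]) = 1.
Proof. by rewrite jones_xiE jevM -jev1; apply: pmxev_eq; vm_compute. Qed.

Lemma jones_xiVK : jev (jxiV_rows [:: 1]) * jones_xi = 1.
Proof. by rewrite jones_xiE jevM -jev1; apply: pmxev_eq; vm_compute. Qed.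

Lemma jones_xi6 : jones_xi ^+ 6 = 1.
Proof.
by rewrite !exprS expr0 mulr1 jones_xiE !jevM -jev1; apply: pmxev_eq; vm_compute.
Qed.

Lemma jones_xi_unit : jones_xi \is a GRing.unit.
Proof.
by apply/unitrP; exists (jev (jxiV_rows [:: 1])); rewrite jones_xiK jones_xiVK.
Qed.

Lemma jones_zetaE (i : 'I_5) : jones_zeta i = jmx i.
Proof.
rewrite /jones_zeta; case: i => i /=; elim: i => [_|i IH lt5].
  by rewrite !expr0 invr1 mul1r mulr1 jones_zeta1E.
rewrite exprS invrM ?unitrX ?jones_xi_unit // !mulrA -2!(mulrA jones_xi).
rewrite IH; last exact: ltnW.
apply: (mulIr jones_xi_unit); rewrite divrK ?jones_xi_unit //.
rewrite /jmx -scalerAr -scalerAl jones_xiE !jevM; congr (_ *: _).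
by apply: pmxev_eq; case: i lt5 {IH} => [|[|[|[|]]]] // _; vm_compute.
Qed.

Lemma jmxM r s : (tL ^- 2 *: jev r) * (tL ^- 2 *: jev s)
  = tL ^- 2 *: (tL ^- 2 *: jev (pmx_mul 5 r s)).
Proof. by rewrite -scalerAl -scalerAr jevM. Qed.

Lemma jones_zetaC (i j : 'I_5) : (i.+1 < j)%N ->
  jones_zeta i * jones_zeta j = jones_zeta j * jones_zeta i.
Proof.
move=> ij; rewrite !jones_zetaE /jmx !jmxM; congr (_ *: (_ *: _)).
apply: pmxev_eq; move: ij; case: i j => i + [j].
by case: j => [|[|[|[|[|j]]]]]; case: i => [|[|[|[|i]]]] // _ _ _; vm_compute.
Qed.

Lemma jones_zetaB (i j : 'I_5) : j = i.+1 :> nat ->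
  jones_zeta i * jones_zeta j * jones_zeta i
  = jones_zeta j * jones_zeta i * jones_zeta j.
Proof.
move=> ij; rewrite !jones_zetaE /jmx !jmxM -!scalerAl -!scalerAr !jevM ij.
congr (_ *: (_ *: (_ *: _))); apply: pmxev_eq.
have : (i < 4)%N by rewrite -ltnS -ij.
by case: {ij} (i : nat) => [|[|[|[|]]]] // _; vm_compute.
Qed.

Lemma jones_prod : \prod_(i <- chain5) jones_zeta i = jones_xi.
Proof.
rewrite /chain5 !big_cons big_nil mulr1 !jones_zetaE /= /jmx.
rewrite -!(scalerAl, scalerAr) !jevM !scalerA.
rewrite (@pmxev_eq _ _ _ _ (jxi_rows [:: 0; 0; 1])); last by vm_compute.
rewrite pmxev_q; last by left.
rewrite scalerA jones_xiE -[RHS]scale1r; congr (_ *: _).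
rewrite -!exprVn -!exprD -exprM exprVn mulVr //.
by rewrite unitrX // tL_unit.
Qed.

Lemma jones_rprod : \prod_(i <- rev chain5) jones_zeta i = jones_xi^-1.
Proof.
apply: (mulrI jones_xi_unit); rewrite divrr ?jones_xi_unit // -[RHS]jones_xiK.
congr (_ * _).
rewrite /chain5 [rev _]/= !big_cons big_nil mulr1 !jones_zetaE /= /jmx.
rewrite -!(scalerAl, scalerAr) !jevM !scalerA.
rewrite (@pmxev_eq _ _ _ _ (jxiV_rows [:: 0; 0; 1])); last by vm_compute.
rewrite pmxev_q; last by right.
rewrite scalerA -[RHS]scale1r; congr (_ *: _).
rewrite -!exprVn -!exprD -exprM exprVn mulVr //.
by rewrite unitrX // tL_unit.
Qed.

Lemma jones_zeta_unit i : jones_zeta i \is a GRing.unit.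
Proof.
have : jones_xi \is a GRing.unit by exact: jones_xi_unit.
rewrite -{1}jones_prod /chain5 big_cons [_ \is a _]unitmx_mul => /andP[u0 _].
rewrite /jones_zeta !unitrMl ?unitrV ?unitrX ?jones_xi_unit //.
by move: u0; rewrite /jones_zeta /= !expr0 invr1 mul1r mulr1.
Qed.

Lemma rho_of w : rho (mcg_of w) = weval jones_zeta w.
Proof.
apply: weval_mcg (mcg_reprE w); first exact: jones_zeta_unit.
- exact: jones_zetaC.
- exact: jones_zetaB.
- by rewrite jones_prod jones_xi6.
- by rewrite jones_prod jones_rprod divrr ?jones_xi_unit // expr1n.
- by move=> i; rewrite jones_prod jones_rprod divrr ?jones_xi_unit // mulr1 mul1r.
Qed.

Lemma rho1 : rho 1%g = 1.
Proof. by rewrite [rho _]rho_of /weval big_nil. Qed.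

Lemma rhoM x y : rho (x * y)%g = rho x * rho y.
Proof.
by rewrite -(mcg_repr x) -(mcg_repr y) -mcg_ofM !rho_of weval_cat.
Qed.

Lemma rho_zeta1 : rho (zeta ord0) = jones_zeta1.
Proof.
by rewrite rho_of weval_z /jones_zeta /= !expr0 invr1 mul1r mulr1.
Qed.

Lemma rho_xi : rho xi = jones_xi.
Proof. by rewrite -mcg_of_chain rho_of weval_chain jones_prod. Qed.

Definition tv_rows (e : int) (i : nat) : pmx :=
  [seq [seq [:: c] | c <- r] | r <- nth [::]
  [:: [:: [:: 1; 0; e; 0]; [:: 0; 1; 0; 0]; [:: 0; 0; 1; 0]; [:: 0; 0; 0; 1]];
      [:: [:: 1; 0; 0; 0]; [:: 0; 1; 0; 0]; [:: -e; 0; 1; 0]; [:: 0; 0; 0; 1]];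
      [:: [:: 1; 0; e; -e]; [:: 0; 1; -e; e]; [:: 0; 0; 1; 0]; [:: 0; 0; 0; 1]];
      [:: [:: 1; 0; 0; 0]; [:: 0; 1; 0; 0]; [:: 0; 0; 1; 0]; [:: 0; -e; 0; 1]];
      [:: [:: 1; 0; 0; 0]; [:: 0; 1; 0; e]; [:: 0; 0; 1; 0]; [:: 0; 0; 0; 1]]]
  i].

Local Notation tev := (pmxev (0 : int) 4).
Local Notation twist := (transvection \o chain_class).

Lemma tev1 : tev (id_rows 4) = 1.
Proof.
apply/matrixP => i j; rewrite !mxE pcoef_mkseq.
by rewrite -val_eqE; case: ifP; rewrite //= mulr0 addr0.
Qed.

Lemma tevM r s : tev r * tev s = tev (pmx_mul 4 r s).
Proof. exact: pmxevM. Qed.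

Lemma twistE i : twist i = tev (tv_rows 1 i).
Proof.
apply/matrixP => j k; rewrite /= /transvection !mxE !big_ord_recl !big_ord0.
rewrite !mxE !big_ord_recl !big_ord0 !mxE.
by case: i => -[|[|[|[|[|]]]]] // ?; case: j => -[|[|[|[|]]]] // ?;
  case: k => -[|[|[|[|]]]] // ?.
Qed.

Lemma twist_unit i : twist i \is a GRing.unit.
Proof.
rewrite twistE; apply/unitrP; exists (tev (tv_rows (-1) i)).
by rewrite !tevM -tev1; split; apply: pmxev_eq;
  case: i => -[|[|[|[|[|]]]]] // ?; vm_compute.
Qed.

Lemma omega_of w : omega (mcg_of w) = weval twist w.
Proof.
apply: weval_mcg (mcg_reprE w); first exact: twist_unit.
- move=> i j ij; rewrite !twistE !tevM; apply: pmxev_eq.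
  move: ij; case: i j => i + [j].
  by case: j => [|[|[|[|[|j]]]]]; case: i => [|[|[|[|i]]]] // _ _ _; vm_compute.
- move=> i j ij; rewrite !twistE !tevM ij; apply: pmxev_eq.
  have : (i < 4)%N by rewrite -ltnS -ij.
  by case: {ij} (i : nat) => [|[|[|[|]]]] // _; vm_compute.
- rewrite /chain5 !big_cons big_nil mulr1 !twistE !exprS expr0 mulr1 !tevM.
  by rewrite -tev1; apply: pmxev_eq; vm_compute.
- rewrite /chain5 [rev _]/= !big_cons big_nil !mulr1 !twistE expr2 !tevM.
  by rewrite -tev1; apply: pmxev_eq; vm_compute.
- move=> i; rewrite /chain5 [rev _]/= !big_cons big_nil !mulr1 !twistE !tevM.
  by apply: pmxev_eq; case: i => -[|[|[|[|[|]]]]] // ?; vm_compute.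
Qed.

Lemma omega1 : omega 1%g = 1.
Proof. by rewrite [omega _]omega_of /weval big_nil. Qed.

Lemma omegaM x y : omega (x * y)%g = omega x * omega y.
Proof.
by rewrite -(mcg_repr x) -(mcg_repr y) -mcg_ofM !omega_of weval_cat.
Qed.

Lemma omega_zeta i : omega (zeta i) = transvection (chain_class i).
Proof. by rewrite omega_of weval_z. Qed.

Lemma omega_symplectic x : is_symplectic (omega x).
Proof.
have symM (g g' : 'M[int]_4) :
    is_symplectic g -> is_symplectic g' -> is_symplectic (g * g').
  move=> /eqP sg /eqP sg'; apply/eqP; rewrite trmx_mul.
  transitivity (g'^T *m (g^T *m symJ int *m g) *m g'); first by rewrite !mulmxA.
  by rewrite sg.
have tr r : (tev r)^T = tev (mkseq (fun a => mkseq (fun b => pcoef r b a) 4) 4).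
  by apply/matrixP => a b; rewrite !mxE pcoef_mkseq.
pose J : pmx := [seq [seq [:: c] | c <- r] | r <-
  [:: [:: 0; 0; 1; 0]; [:: 0; 0; 0; 1]; [:: -1; 0; 0; 0]; [:: 0; -1; 0; 0]]].
have JE : symJ int = tev J.
  apply/matrixP => a b; rewrite !mxE.
  by case: a => -[|[|[|[|]]]] // ?; case: b => -[|[|[|[|]]]] // ?.
have symE e (i : 'I_5) : (e == 1) || (e == -1) -> is_symplectic (tev (tv_rows e i)).
  rewrite /is_symplectic tr JE !mulmxE !tevM => e1; apply/eqP/pmxev_eq.
  by case/orP: e1 => /eqP->; case: i => -[|[|[|[|[|]]]]] // ?; vm_compute.
have twistV i : (twist i)^-1 = tev (tv_rows (-1) i).
  rewrite twistE; apply: (mulIr (x := tev (tv_rows 1 i))).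
    by rewrite -twistE twist_unit.
  rewrite mulVr -?twistE ?twist_unit // twistE tevM -tev1; apply: pmxev_eq.
  by case: i => -[|[|[|[|[|]]]]] // ?; vm_compute.
rewrite -(mcg_repr x) omega_of; elim: (repr x) => [|[i b] w IH].
  by rewrite /weval big_nil /is_symplectic trmx1 mul1mx mulmx1.
rewrite -cat1s weval_cat; apply: symM => //.
rewrite /weval big_seq1; case: b.
  by change (is_symplectic (twist i)); rewrite twistE symE.
by change (is_symplectic (twist i)^-1); rewrite twistV symE.
Qed.

Definition torelli (x : mcg) : Prop := omega x = 1.

Definition phi (x : mcg) : 'M[fps]_5 := map_mx subst_exp (rho x).

Lemma phiM x y : phi (x * y)%g = phi x * phi y.
Proof. by rewrite /phi rhoM; apply: map_mxM. Qed.

Definition hfil (k : nat) (B : 'M[fps]_5) : Prop :=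
  exists B', B = hvar ^+ k *: B'.

(** For k >= 1 this is F_k, the kernel of phi^(k-1) in the Torelli group, as
    phi^(k-1) is the reduction of phi modulo R[k]. *)
Definition jones_fil (k : nat) (x : mcg) : Prop :=
  torelli x /\ hfil k (phi x - 1).

Lemma phi1 : phi 1%g = 1.
Proof. by rewrite /phi rho1; apply: map_mx1. Qed.

Lemma jones_fil_conj k m x : jones_fil k x -> jones_fil k (m * x * m^-1)%g.
Proof.
move=> [tx [B phix]]; split.
  by rewrite /torelli !omegaM tx mulr1 -omegaM mulgV omega1.
exists (phi m * B * phi (m^-1)%g).
rewrite !phiM -[X in _ - X]phi1 -(mulgV m) phiM -mulrBl -{2}[phi m]mulr1.
by rewrite -mulrBr phix -scalerAr -scalerAl.
Qed.

(** * The rational vector space (A / B) (x) Q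

    For subsets B <= A of a group, [quotQ A B] is the group of formal sums of
    pairs (x, c), standing for x (x) c with x in A and c rational, modulo the
    defining relations of the tensor product and x (x) c = 0 for x in B.  It
    is (A / B) (x) Q when A is a subgroup and B a normal subgroup of A with
    abelian quotient. *)

Section QuotQ.
Variables (G : groupType) (A B : G -> Prop).

Definition memb : Type := {x : G | `[< A x >]}.
HB.instance Definition _ := Choice.on memb.
Definition formal_sum : Type := seq (memb * rat).
HB.instance Definition _ := Choice.on formal_sum.

Inductive tens_eq : formal_sum -> formal_sum -> Prop :=
| tens_refl s : tens_eq s s
| tens_sym s t : tens_eq s t -> tens_eq t s
| tens_trans s t u : tens_eq s t -> tens_eq t u -> tens_eq s u
| tens_cat s s' t t' :
    tens_eq s s' -> tens_eq t t' -> tens_eq (s ++ t) (s' ++ t')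
| tens_comm s t : tens_eq (s ++ t) (t ++ s)
| tens_mull (x y z : memb) c : val z = (val x * val y)%g ->
    tens_eq [:: (z, c)] [:: (x, c); (y, c)]
| tens_addr x c d : tens_eq [:: (x, c + d)] [:: (x, c); (x, d)]
| tens_zero x : tens_eq [:: (x, 0)] [::]
| tens_quot (x : memb) c : B (val x) -> tens_eq [:: (x, c)] [::].

Definition tens_eqb : rel formal_sum := fun s t => `[< tens_eq s t >].

Lemma tens_eqb_refl : reflexive tens_eqb.
Proof. by move=> s; apply/asboolP/tens_refl. Qed.
Lemma tens_eqb_sym : symmetric tens_eqb.
Proof. by move=> s t; apply/asboolP/asboolP => /tens_sym. Qed.
Lemma tens_eqb_trans : transitive tens_eqb.
Proof.
by move=> t s u /asboolP st /asboolP tu; apply/asboolP/(tens_trans st tu).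
Qed.

Canonical tens_equiv :=
  EquivRel tens_eqb tens_eqb_refl tens_eqb_sym tens_eqb_trans.

Definition quotQ : Type := {eq_quot tens_equiv}.
HB.instance Definition _ := Choice.on quotQ.
HB.instance Definition _ := EqQuotient.on quotQ.

Definition quotQ_of (s : formal_sum) : quotQ := \pi_quotQ s.

Lemma quotQ_ofP s t : quotQ_of s = quotQ_of t <-> tens_eq s t.
Proof.
split=> [/eqquotP/asboolP //|st]; apply/eqquotP; exact/asboolP.
Qed.

Lemma quotQ_repr (v : quotQ) : quotQ_of (repr v) = v.
Proof. exact: reprK. Qed.

Lemma quotQ_reprE s : tens_eq (repr (quotQ_of s)) s.
Proof. by apply/quotQ_ofP; rewrite quotQ_repr. Qed.

Definition fscale (c : rat) (s : formal_sum) : formal_sum :=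
  [seq (p.1, c * p.2) | p <- s].

Lemma tens_fscale c s t : tens_eq s t -> tens_eq (fscale c s) (fscale c t).
Proof.
elim=> {s t} /=.
- by move=> s; apply: tens_refl.
- by move=> s t _; apply: tens_sym.
- by move=> s t u _ st _; apply: tens_trans.
- by move=> s s' t t' _ ss _ tt; rewrite /fscale !map_cat; apply: tens_cat.
- by move=> s t; rewrite /fscale !map_cat; apply: tens_comm.
- by move=> x y z d e; apply: tens_mull.
- by move=> x d e; rewrite mulrDr; apply: tens_addr.
- by move=> x; rewrite mulr0; apply: tens_zero.
- by move=> x d Bx; apply: tens_quot.
Qed.

Definition quotQ_zero : quotQ := quotQ_of [::].
Definition quotQ_add (u v : quotQ) : quotQ := quotQ_of (repr u ++ repr v).
Definition quotQ_scale (c : rat) (v : quotQ) : quotQ :=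
  quotQ_of (fscale c (repr v)).
Definition quotQ_opp (v : quotQ) : quotQ := quotQ_scale (-1) v.

Lemma quotQ_addE s t : quotQ_add (quotQ_of s) (quotQ_of t) = quotQ_of (s ++ t).
Proof. by apply/quotQ_ofP/tens_cat; apply: quotQ_reprE. Qed.
Lemma quotQ_scaleE c s : quotQ_scale c (quotQ_of s) = quotQ_of (fscale c s).
Proof. by apply/quotQ_ofP/tens_fscale; apply: quotQ_reprE. Qed.

Lemma fscaleDl c d s : tens_eq (fscale (c + d) s) (fscale c s ++ fscale d s).
Proof.
elim: s => [|[x e] s IH] /=; first exact: tens_refl.
rewrite -cat1s -[X in tens_eq _ X]cat1s mulrDl.
apply: tens_trans (tens_cat (tens_addr x (c * e) (d * e)) IH) _.
have -> : [:: (x, c * e); (x, d * e)] ++ fscale c s ++ fscale d s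
        = [:: (x, c * e)] ++ ([:: (x, d * e)] ++ fscale c s) ++ fscale d s by [].
have -> : [:: (x, c * e)] ++ (fscale c s ++ (x, d * e) :: fscale d s)
        = [:: (x, c * e)] ++ (fscale c s ++ [:: (x, d * e)]) ++ fscale d s.
  by rewrite -catA.
apply: tens_cat; first exact: tens_refl.
by apply: tens_cat; [exact: tens_comm | exact: tens_refl].
Qed.

Lemma fscale0 s : tens_eq (fscale 0 s) [::].
Proof.
elim: s => [|[x e] s IH] /=; first exact: tens_refl.
by rewrite mul0r -cat1s -[[::]]cats0; apply: tens_cat => //; apply: tens_zero.
Qed.

Lemma fscale1 s : fscale 1 s = s.
Proof.
by rewrite -[RHS]map_id; apply: eq_map => -[x c]; rewrite mul1r.
Qed.

Lemma quotQ_addA : associative quotQ_add.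
Proof.
move=> u v w; rewrite -(quotQ_repr u) -(quotQ_repr v) -(quotQ_repr w).
by rewrite !quotQ_addE catA.
Qed.
Lemma quotQ_addC : commutative quotQ_add.
Proof. by move=> u v; apply/quotQ_ofP/tens_comm. Qed.
Lemma quotQ_add0 : left_id quotQ_zero quotQ_add.
Proof. by move=> v; rewrite -(quotQ_repr v) quotQ_addE. Qed.
Lemma quotQ_scaleDl v c d :
  quotQ_scale (c + d) v = quotQ_add (quotQ_scale c v) (quotQ_scale d v).
Proof.
rewrite -(quotQ_repr v) !quotQ_scaleE quotQ_addE; exact/quotQ_ofP/fscaleDl.
Qed.
Lemma quotQ_scale1 : left_id 1 quotQ_scale.
Proof. by move=> v; rewrite -(quotQ_repr v) quotQ_scaleE fscale1. Qed.
Lemma quotQ_addN : left_inverse quotQ_zero quotQ_opp quotQ_add.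
Proof.
move=> v; rewrite -{2}(quotQ_scale1 v) -quotQ_scaleDl addNr.
by rewrite -(quotQ_repr v) quotQ_scaleE; apply/quotQ_ofP/fscale0.
Qed.

HB.instance Definition _ := GRing.isZmodule.Build quotQ
  quotQ_addA quotQ_addC quotQ_add0 quotQ_addN.

Lemma quotQ_scaleA c d v :
  quotQ_scale c (quotQ_scale d v) = quotQ_scale (c * d) v.
Proof.
rewrite -(quotQ_repr v) !quotQ_scaleE /fscale -map_comp; congr quotQ_of.
by apply: eq_map => -[x e] /=; rewrite mulrA.
Qed.
Lemma quotQ_scaleDr : right_distributive quotQ_scale +%R.
Proof.
move=> c u v; rewrite -(quotQ_repr u) -(quotQ_repr v).
by rewrite [X in quotQ_scale _ X]quotQ_addE !quotQ_scaleE
  [RHS]quotQ_addE /fscale map_cat.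
Qed.
Lemma quotQ_scaleDl_morph v :
  {morph quotQ_scale^~ v : c d / c + d >-> c + d}.
Proof. exact: quotQ_scaleDl. Qed.

HB.instance Definition _ := GRing.Zmodule_isLmodule.Build rat quotQ
  quotQ_scaleA quotQ_scale1 quotQ_scaleDr quotQ_scaleDl_morph.

Definition tens (x : memb) (c : rat) : quotQ := quotQ_of [:: (x, c)].

End QuotQ.

Definition grF (k : nat) : lmodType rat :=
  quotQ (jones_fil k) (jones_fil k.+1).

From mathcomp Require Import mpoly.

(** * Rational representations of Sp(4,Q)

    An action of Sp(4,Q) on V is given by a function on all 4 x 4 matrices, of
    which only the values on symplectic ones matter. *)

Record sp_action (V : lmodType rat) (act : 'M[rat]_4 -> V -> V) : Prop := {
  sp_act_linear : forall g, is_symplectic g -> linear (act g);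
  sp_act1 : forall v, act 1 v = v;
  sp_actM : forall g g' v, is_symplectic g -> is_symplectic g' ->
    act (g * g') v = act g (act g' v) }.

(** V has a finite basis in which the matrix coefficients of the action are
    polynomial functions of the 16 entries of the group element. *)
Definition algebraic_action (V : lmodType rat) (act : 'M[rat]_4 -> V -> V) :
    Prop :=
  exists (n : nat) (e : 'I_n -> V) (P : 'I_n -> 'I_n -> {mpoly rat[4 * 4]}),
    (forall v, exists! c : 'rV[rat]_n, v = \sum_i c 0 i *: e i) /\
    (forall g j, is_symplectic g ->
       act g (e j) = \sum_i (P i j).@[fun l => mxvec g 0 l] *: e i).

Definition rational_rep (V : lmodType rat) (act : 'M[rat]_4 -> V -> V) : Prop :=
  sp_action act /\ algebraic_action act.

Definition sp_submodule (V : lmodType rat) (act : 'M[rat]_4 -> V -> V)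
    (W : V -> Prop) : Prop :=
  [/\ W 0, forall c u v, W u -> W v -> W (c *: u + v)
    & forall g v, is_symplectic g -> W v -> W (act g v)].

Definition irreducible_rep (V : lmodType rat) (act : 'M[rat]_4 -> V -> V) :
    Prop :=
  (exists v : V, v <> 0) /\
  (forall W, sp_submodule act W -> (forall v, W v -> v = 0) \/ (forall v, W v)).

(** The torus diag(x, y, x^-1, y^-1), on which L_1 and L_2 are the characters
    x and y. *)
Definition torus (x y : rat) : 'M[rat]_4 :=
  diag_mx (\row_j nth 0 [:: x; y; x^-1; y^-1] j).

(** The unipotent radical of the Borel subgroup with positive roots L_1 - L_2,
    L_1 + L_2, 2 L_1 and 2 L_2: the symplectic block matrices (a b; 0 d) with
    a upper unitriangular. *)
Definition pos_unipotent (g : 'M[rat]_4) : Prop :=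
  is_symplectic g /\
  (forall i j : 'I_4, (j < 2)%N -> (j <= i)%N -> g i j = (i == j)%:R).

(** v is a highest weight vector of weight a L_1 + b (L_1 + L_2). *)
Definition highest_weight_vector (V : lmodType rat)
    (act : 'M[rat]_4 -> V -> V) (a b : nat) (v : V) : Prop :=
  [/\ v <> 0,
      forall x y, x != 0 -> y != 0 ->
        act (torus x y) v = (x ^+ (a + b) * y ^+ b) *: v
    & forall g, pos_unipotent g -> act g v = v].

(** A representation with these properties is unique up to isomorphism; it is
    Gamma_{a,b}. *)
Definition is_Gamma (a b : nat) (V : lmodType rat)
    (act : 'M[rat]_4 -> V -> V) : Prop :=
  [/\ rational_rep act, irreducible_rep act
    & exists v, highest_weight_vector act a b v].

Definition contains_Gamma (a b : nat) (V : lmodType rat)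
    (act : 'M[rat]_4 -> V -> V) : Prop :=
  exists (U : lmodType rat) (actU : 'M[rat]_4 -> U -> U) (f : {linear U -> V}),
    [/\ is_Gamma a b actU, injective f
      & forall g u, is_symplectic g -> f (actU g u) = act g (f u)].

(** The rational action of Sp(4,Q) on gr_k F (x) Q extending the action of
    Sp(4,Z) induced by conjugation; Sp(4,Z) being Zariski dense in Sp(4,Q),
    it is unique. *)
Definition grF_action (k : nat) (act : 'M[rat]_4 -> grF k -> grF k) : Prop :=
  rational_rep act /\
  (forall (m : mcg) (x y : memb (jones_fil k)) (c : rat),
     val y = (m * val x * m^-1)%g ->
     act (map_mx intr (omega m)) (tens _ x c) = tens _ y c).

(* Main.v *)
(** Let L_k(x) be the coefficient of h^k in phi(x) - 1 for x in F_k.  It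
    identifies gr_k F (x) Q with the rational span of the L_k(x) in M(5,Q).  At
    h = 0, phi is up to sign the action on the primitive part Gamma_{0,1} of the
    exterior square of H, which preserves a symmetric form J.  This form deforms
    to a form over Q[[h]] preserved by phi and hermitian for h |-> - h, so L_k(x)
    is skew for J if k is even and symmetric if k is odd; it is traceless because
    det phi(x) is a root of unity.  These skew, resp. traceless symmetric,
    endomorphisms form Gamma_{2,0}, resp. Gamma_{0,2}, and both remain
    irreducible under the image of the mapping class group.  Hence it suffices
    that some L_k(x) is nonzero for each k >= 1, and then gr_k F (x) Q is the
    whole irreducible module.  For k = 1 one takes the twist along a separating
    curve; from k to k + 1 one uses L_{k+1}([x,y]) = [L_1(x), L_k(y)]. *)
Require Import Defs.
From mathcomp Require Import all_boot all_order all_algebra.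
From HB Require Import structures.
From mathcomp Require Import perm boolp mpoly ring lra.
Import Defs.

Set Implicit Arguments.
Unset Strict Implicit.
Unset Printing Implicit Defensive.

Import GRing.Theory Num.Theory.
Local Open Scope ring_scope.

(** Two density arguments are avoided. The image of L_k is only known to be a rational subspace
    stable under the mapping class group. But at h = 0 the twists act, up to sign, by 1 + N with N^2
    = 0, so conjugation by a twist and by its inverse yields the operators A |-> [N, A] and A |-> N
    A N. The first kind carries the highest weight vector over the whole module; the second brings a
    suitable element of any nonzero submodule back to the highest weight vector. Once the image is
    known to be the full space of skew, resp. traceless symmetric, matrices, it is stable under
    Sp(4,Q), so the rational action is defined by transport through L_k and not by extension from
    Sp(4,Z). Identities between explicit matrices are checked by computation on matrices of integer
    coefficient lists in one variable, which is then specialised to q = t^5, to h or to 0. *)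

Local Notation o4 k := (@Ordinal 4 k isT).
Local Notation o5 k := (@Ordinal 5 k isT).
Local Notation Om := (symJ rat).

(** * Power series *)

Lemma fpsM0 (f g : fps) : (f * g) 0%N = f 0%N * g 0%N.
Proof. by rewrite [LHS]big_ord_recl big_ord0 addr0. Qed.

Lemma fpsM1 (f g : fps) : (f * g) 1%N = f 0%N * g 1%N + f 1%N * g 0%N.
Proof. by rewrite [LHS]big_ord_recl big_ord_recl big_ord0 addr0. Qed.

Definition fcoef (n : nat) (f : fps) : rat := f n.

Lemma fcoef_is_zmod n : zmod_morphism (fcoef n). Proof. by []. Qed.
HB.instance Definition _ n :=
  GRing.isZmodMorphism.Build fps rat (fcoef n) (fcoef_is_zmod n).

Definition fps_at0 (f : fps) : rat := f 0%N.
Lemma fps_at0_is_zmod : zmod_morphism fps_at0. Proof. by []. Qed.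
Lemma fps_at0_is_monoid : monoid_morphism fps_at0.
Proof. by split=> // f g; apply: fpsM0. Qed.
HB.instance Definition _ :=
  GRing.isZmodMorphism.Build fps rat fps_at0 fps_at0_is_zmod.
HB.instance Definition _ :=
  GRing.isMonoidMorphism.Build fps rat fps_at0 fps_at0_is_monoid.

Lemma hvarM (f : fps) n : (hvar * f) n = if n is m.+1 then f m else 0.
Proof.
case: n => [|n]; first by rewrite fpsM0 mul0r.
rewrite [LHS]big_ord_recl /= mul0r add0r big_ord_recl mul1r subSS subn0.
by rewrite big1 ?addr0 // => i _; rewrite /hvar /= mul0r.
Qed.

Lemma hvarXM k (f : fps) n :
  (hvar ^+ k * f) n = if (n < k)%N then 0 else f (n - k)%N.
Proof.
elim: k n => [|k IH] n; first by rewrite expr0 mul1r subn0.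
rewrite exprS -mulrA hvarM; case: n => [//|n].
by rewrite IH ltnS subSS.
Qed.

Lemma hvarX_divP k (f : fps) :
  (forall n, (n < k)%N -> f n = 0) -> f = hvar ^+ k * (fun n => f (n + k)%N : rat).
Proof.
move=> f0; apply/funext => n; rewrite hvarXM.
by case: ltnP => [/f0//|kn]; rewrite subnK.
Qed.

Lemma hvarX_inj k : injective (fun f : fps => hvar ^+ k * f).
Proof.
move=> f g /= e; apply/funext => n.
have := congr1 (fcoef (n + k)) e.
by rewrite /fcoef !hvarXM ltnNge leq_addl /= addnK.
Qed.

(** The substitution h |-> -h. It exchanges t = -e^h and t^-1, so it is the conjugation for which
    the invariant form is hermitian. *)
Definition fps_bar (f : fps) : fps := fun n => (-1) ^+ n * f n.

Lemma fps_bar_is_zmod : zmod_morphism fps_bar.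
Proof. by move=> f g; apply/funext => n; apply: mulrBr. Qed.
Lemma fps_bar_is_monoid : monoid_morphism fps_bar.
Proof.
split=> [|f g]; apply/funext => n.
  by case: n => [|n]; rewrite /fps_bar ?mul1r ?mulr0.
rewrite [RHS]/GRing.mul /= /fps_mul /fps_bar mulr_sumr; apply: eq_bigr => i _.
by rewrite mulrACA -exprD subnKC // -ltnS.
Qed.
HB.instance Definition _ :=
  GRing.isZmodMorphism.Build fps fps fps_bar fps_bar_is_zmod.
HB.instance Definition _ :=
  GRing.isMonoidMorphism.Build fps fps fps_bar fps_bar_is_monoid.

Lemma fps_bar_hvar : fps_bar hvar = - hvar.
Proof.
by apply/funext => -[|[|n]] //; rewrite /fps_bar /hvar mulr0 -[RHS]/(- 0) oppr0.
Qed.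

Lemma fps_bar_exp c : fps_bar (expfps c) = expfps (- c).
Proof. by apply/funext => n; rewrite /fps_bar /expfps (exprNn c) mulrA. Qed.

Lemma expfpsX c n : expfps c ^+ n = expfps (c *+ n).
Proof.
elim: n => [|n IH]; first by rewrite mulr0n expfps0.
by rewrite exprS IH expfpsD mulrS.
Qed.

Lemma expfps_at0 c : expfps c 0%N = 1.
Proof. by rewrite /expfps expr0 divr1. Qed.
Lemma expfps_at1 c : expfps c 1%N = c.
Proof. by rewrite /expfps expr1 divr1. Qed.

(** * Orders of vanishing *)

Definition cmx (n : nat) (B : 'M[fps]_5) : 'M[rat]_5 := map_mx (fcoef n) B.

Lemma cmxB n A B : cmx n (A - B) = cmx n A - cmx n B.
Proof. exact: map_mxB. Qed.
Lemma cmxD n A B : cmx n (A + B) = cmx n A + cmx n B.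
Proof. exact: map_mxD. Qed.
Lemma cmx0M A B : cmx 0 (A * B) = cmx 0 A * cmx 0 B.
Proof. exact: (map_mxM fps_at0). Qed.
Lemma cmx0_1 : cmx 0 1 = 1.
Proof. exact: (map_mx1 fps_at0). Qed.

Lemma hfilP k B : hfil k B <-> forall n, (n < k)%N -> cmx n B = 0.
Proof.
split=> [[A ->] n nk|B0].
  by apply/matrixP => i j; rewrite !mxE /fcoef hvarXM nk.
exists (\matrix_(i, j) ((fun n => B i j (n + k)%N) : fps)).
apply/matrixP => i j; rewrite !mxE; apply: hvarX_divP => n nk.
by have /matrixP/(_ i j) := B0 n nk; rewrite !mxE.
Qed.

Lemma cmx_hvarX k (B : 'M[fps]_5) : cmx k (hvar ^+ k *: B) = cmx 0 B.
Proof. by apply/matrixP => i j; rewrite !mxE /fcoef hvarXM ltnn subnn. Qed.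

Lemma hvarXZ_inj k : injective (fun B : 'M[fps]_5 => hvar ^+ k *: B).
Proof.
move=> A B /matrixP e; apply/matrixP => i j; have := e i j.
by rewrite !mxE; apply: hvarX_inj.
Qed.

Lemma hfilS k B : hfil k B -> cmx k B = 0 -> hfil k.+1 B.
Proof.
move=> /hfilP B0 Bk; apply/hfilP => n; rewrite ltnS leq_eqVlt.
by case/predU1P => [->//|/B0].
Qed.
Lemma hfilD k A B : hfil k A -> hfil k B -> hfil k (A + B).
Proof. by move=> [A' ->] [B' ->]; exists (A' + B'); rewrite scalerDr. Qed.
Lemma hfilMl k A B : hfil k A -> hfil k (B * A).
Proof. by move=> [A' ->]; exists (B * A'); rewrite -scalerAr. Qed.
Lemma hfilMr k A B : hfil k A -> hfil k (A * B).
Proof. by move=> [A' ->]; exists (A' * B); rewrite -scalerAl. Qed.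

Lemma hfil_congM k A A' B B' :
  hfil k (A - A') -> hfil k (B - B') -> hfil k (A * B - A' * B').
Proof.
move=> hA hB; have -> : A * B - A' * B' = (A - A') * B + A' * (B - B').
  by rewrite mulrBl mulrBr addrA subrK.
by apply: hfilD; [apply: hfilMr | apply: hfilMl].
Qed.

(** * Values of the representations on the generators *)

Lemma mcg_ind (P : mcg -> Prop) :
  P 1%g -> (forall x y, P x -> P y -> P (x * y)%g) ->
  (forall x, P x -> P (x^-1)%g) -> (forall i, P (zeta i)) -> forall x, P x.
Proof.
move=> P1 PM PV Pz x; rewrite -(mcg_repr x).
elim: (repr x) => [|[i b] w IH]; first exact: P1.
rewrite -cat1s mcg_ofM; apply: PM => //; case: b; first exact: Pz.
have -> : mcg_of [:: (i, false)] = ((zeta i)^-1)%g by rewrite [RHS]mcg_invE.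
exact/PV/Pz.
Qed.

Lemma pev_rmorph (A B : comNzRingType) (f : {rmorphism A -> B}) q p :
  f (pev q p) = pev (f q) p.
Proof.
by elim: p => [|a p IH] /=; rewrite ?rmorph0 // rmorphD rmorphM IH rmorph_int.
Qed.

Lemma pmxev_rmorph (A B : comNzRingType) (f : {rmorphism A -> B}) q n r :
  map_mx f (pmxev q n r) = pmxev (f q) n r.
Proof. by apply/matrixP => i j; rewrite !mxE pev_rmorph. Qed.

Lemma pmxM (A : comNzRingType) (q : A) n r s :
  pmxev q n.+1 r * pmxev q n.+1 s = pmxev q n.+1 (pmx_mul n.+1 r s).
Proof. exact: pmxevM. Qed.

Lemma subst_exp_tLV : subst_exp (tL^-1) = - expfps (- 1).
Proof.
have e : subst_exp tL * subst_exp (tL^-1) = 1.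
  by rewrite -rmorphM divrr ?tL_unit // rmorph1.
by rewrite -[LHS]mul1r -Defs.tvalK /Defs.tval -subst_exp_tL mulrAC e mul1r.
Qed.

Lemma rho_zeta i : rho (zeta i) = tL ^- 2 *: pmxev (tL ^+ 5) 5 (jrows i).
Proof. by rewrite rho_of weval_z jones_zetaE. Qed.

Lemma phi_zeta i :
  phi (zeta i) = expfps (- 2) *: pmxev (- expfps 5) 5 (jrows i).
Proof.
rewrite /phi rho_zeta map_mxZ pmxev_rmorph -exprVn !rmorphXn /=.
rewrite subst_exp_tLV subst_exp_tL sqrrN expfpsX.
have -> : (- expfps 1) ^+ 5 = - expfps 5.
  by rewrite exprNn expfpsX -signr_odd expr1 mulN1r.
by congr (expfps _ *: _); lra.
Qed.

(** The entries of t^2 rho(zeta_i) have the form a + b q; through the coercion to [nat], [false]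
    selects a and [true] selects b. *)
Definition jpair (i : 'I_5) (a b : 'I_5) (j : bool) : int :=
  nth 0 (pcoef (jrows i) a b) j.

Lemma size_jrows (i a b : 'I_5) : (size (pcoef (jrows i) a b) <= 2)%N.
Proof.
by case: i => -[|[|[|[|[|]]]]] //= _; case: a => -[|[|[|[|[|]]]]] //= _;
  case: b => -[|[|[|[|[|]]]]].
Qed.

Lemma pev_size2 (A : comNzRingType) (q : A) p : (size p <= 2)%N ->
  pev q p = (nth 0 p 0)%:~R + q * (nth 0 p 1)%:~R.
Proof.
case: p => [|a [|b [|]]] //= _; rewrite ?mulr0 ?addr0 //.
Qed.

Lemma phi_zetaE i a b : phi (zeta i) a b =
  (jpair i a b false)%:~R * expfps (- 2) - (jpair i a b true)%:~R * expfps 3.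
Proof.
rewrite phi_zeta !mxE pev_size2 ?size_jrows // mulrDr mulNr mulrN mulrA expfpsD.
by congr (_ - _); rewrite mulrC //; congr (_ * expfps _); lra.
Qed.

Lemma phiV x : phi x * phi (x^-1)%g = 1.
Proof. by rewrite -phiM mulgV phi1. Qed.
Lemma phiVx x : phi (x^-1)%g * phi x = 1.
Proof. by rewrite -phiM mulVg phi1. Qed.

Definition herm_rows : pmx :=
  [:: [:: [:: 1; 2; 1]; [:: 0; -1; -1]; [:: 0; 2]; [:: 0; -1; -1]; [:: 0; -1; -1]];
      [:: [:: -1; -1]; [:: 1; 1; 1]; [:: -1; -1]; [:: 0; 1]; [:: 0; 1]];
      [:: [:: 0; 2]; [:: 0; -1; -1]; [:: 1; 2; 1]; [:: 0; -1; -1]; [:: 0; -1; -1]];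
      [:: [:: -1; -1]; [:: 0; 1]; [:: -1; -1]; [:: 1; 1; 1]; [:: 0; 1]];
      [:: [:: -1; -1]; [:: 0; 1]; [:: -1; -1]; [:: 0; 1]; [:: 1; 1; 1]]].

(* The hermitian form has coefficients in Z[q,q^-1] with q = t^5; this is q
   times its matrix. *)
Definition herm : 'M[fps]_5 := pmxev (- expfps 5) 5 herm_rows.

Definition barmx (B : 'M[fps]_5) : 'M[fps]_5 := map_mx fps_bar B.

Lemma barmxM A B : barmx (A * B) = barmx A * barmx B.
Proof. exact: map_mxM. Qed.

Lemma phi_herm x : (barmx (phi x))^T * herm * phi x = herm.
Proof.
have trM (A B : 'M[fps]_5) : (A * B)^T = B^T * A^T by exact: trmx_mul.
elim/mcg_ind: x => [|x y ex ey|x ex|i].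
- by rewrite phi1 /barmx map_mx1 trmx1 mul1r mulr1.
- by rewrite phiM barmxM trM -[RHS]ey -[in RHS]ex !mulrA.
- rewrite -[X in _ * X * _]ex !mulrA -(mulrA _ (phi x)) phiV mulr1.
  by rewrite -trM -barmxM phiV /barmx map_mx1 trmx1 mul1r.
pose Q : fps := - expfps 5; pose Qb : fps := - expfps (- 5).
have QQ : Q * Qb = 1 by rewrite mulrNN expfpsD subrr expfps0.
(* The conjugation sends t^-2 (a + b q) to t^2 q^-1 (b + a q). So [rv] transposes and reverses the
   coefficient pairs, and the invariance becomes [rv] * [herm_rows] * [jrows i] = q * [herm_rows],
   an identity over Z[q]. *)
pose rv : pmx := mkseq (fun a => mkseq (fun b =>
  [:: nth 0 (pcoef (jrows i) b a) 1; nth 0 (pcoef (jrows i) b a) 0]) 5) 5.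
have -> : (barmx (phi (zeta i)))^T = (expfps 2 * Qb) *: pmxev Q 5 rv.
  rewrite phi_zeta /barmx map_mxZ pmxev_rmorph rmorphN /= !fps_bar_exp opprK.
  apply/matrixP => a b; rewrite !mxE pcoef_mkseq !pev_size2 ?size_jrows //=.
  by rewrite -/Qb -mulrA (mulrDr Qb) (mulrA Qb) (mulrC Qb Q) QQ mul1r addrC.
rewrite phi_zeta /herm -/Q -!scalerAl -!scalerAr scalerA mulrAC expfpsD subrr.
rewrite expfps0 mul1r !pmxM.
have -> : pmxev Q 5 (pmx_mul 5 (pmx_mul 5 rv herm_rows) (jrows i))
        = pmxev Q 5 (mkseq (fun a => mkseq (fun b => 0 :: pcoef herm_rows a b)
          5) 5).
  by apply: pmxev_eq; rewrite /rv; case: i {rv} => -[|[|[|[|[|]]]]] // ?;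
    vm_compute.
apply/matrixP => a b; rewrite !mxE pcoef_mkseq /= add0r mulrA.
by rewrite (mulrC Qb) QQ mul1r.
Qed.

(** * Leading coefficients *)

Definition lead (k : nat) (x : mcg) : 'M[rat]_5 := cmx k (phi x - 1).

Lemma jones_fil_expand k x : jones_fil k x ->
  exists2 A, phi x = 1 + hvar ^+ k *: A & lead k x = cmx 0 A.
Proof.
move=> [_ [A e]]; exists A; last by rewrite /lead e cmx_hvarX.
by rewrite -e addrC subrK.
Qed.

Lemma lead_expand k x A : phi x = 1 + hvar ^+ k *: A -> lead k x = cmx 0 A.
Proof. by rewrite /lead => ->; rewrite addrC addKr cmx_hvarX. Qed.

Lemma jones_filI k x A : torelli x -> phi x = 1 + hvar ^+ k *: A -> jones_fil k x.
Proof. by move=> tx e; split=> //; exists A; rewrite e addrC addKr. Qed.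

Lemma torelliM x y : torelli x -> torelli y -> torelli (x * y)%g.
Proof. by rewrite /torelli omegaM => -> ->; rewrite mulr1. Qed.

Lemma torelliV x : torelli x -> torelli (x^-1)%g.
Proof. by rewrite /torelli => e; rewrite -[LHS]mulr1 -e -omegaM mulVg omega1. Qed.

Lemma jones_fil1 k : jones_fil k 1%g.
Proof.
by apply: (@jones_filI _ _ 0); [apply: omega1 | rewrite scaler0 addr0 phi1].
Qed.

Lemma phiM_expand k x y A B :
  phi x = 1 + hvar ^+ k *: A -> phi y = 1 + hvar ^+ k *: B ->
  phi (x * y)%g = 1 + hvar ^+ k *: (A + B + hvar ^+ k *: (A * B)).
Proof.
move=> ex ey; rewrite phiM ex ey mulrDl !mulrDr !mul1r mulr1.
by rewrite -scalerAl -scalerAr !scalerDr -!addrA; congr (_ + _); rewrite addrCA.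
Qed.

Lemma jones_filM k x y :
  jones_fil k x -> jones_fil k y -> jones_fil k (x * y)%g.
Proof.
move=> fx fy; have [A ex _] := jones_fil_expand fx.
have [B ey _] := jones_fil_expand fy.
exact: jones_filI (torelliM fx.1 fy.1) (phiM_expand ex ey).
Qed.

(** The cross term h^(2k) A B does not reach the coefficient of h^k, as k > 0. *)
Lemma leadM k x y : (0 < k)%N -> jones_fil k x -> jones_fil k y ->
  lead k (x * y)%g = lead k x + lead k y.
Proof.
move=> k0 fx fy; have [A ex ->] := jones_fil_expand fx.
have [B ey ->] := jones_fil_expand fy.
rewrite (lead_expand (phiM_expand ex ey)) !cmxD.
have /hfilP -> // : hfil k (hvar ^+ k *: (A * B)) by exists (A * B).
by rewrite addr0.
Qed.

Lemma jones_filV k x : jones_fil k x -> jones_fil k (x^-1)%g.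
Proof.
move=> [tx hx]; split; first exact: torelliV.
have -> : phi (x^-1)%g - 1 = (phi x - 1) * (- phi (x^-1)%g).
  by rewrite mulrN mulrBl phiV mul1r opprB.
exact: hfilMr.
Qed.

Lemma jones_filS k x : jones_fil k.+1 x <-> jones_fil k x /\ lead k x = 0.
Proof.
split=> [[tx /hfilP hx]|[[tx hx] l0]].
  by split; [split=> //; apply/hfilP => n nk; apply/hx/ltnW | apply: hx].
by split=> //; apply: hfilS.
Qed.

Lemma lead_conj k m x : jones_fil k x ->
  lead k (m * x * m^-1)%g = cmx 0 (phi m) * lead k x * cmx 0 (phi (m^-1)%g).
Proof.
move=> fx; have [A ex ->] := jones_fil_expand fx.
rewrite (@lead_expand k _ (phi m * A * phi (m^-1)%g)) ?cmx0M //.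
by rewrite !phiM ex mulrDr mulr1 mulrDl phiV -scalerAr -scalerAl.
Qed.

Definition mcg_comm (x y : mcg) : mcg := (x * y * x^-1 * y^-1)%g.

(** The difference phi(x) phi(y) - phi(y) phi(x) equals h^(k+l) (A B - B A) exactly; multiplying it
    by phi(x^-1) phi(y^-1) on the right gives the commutator minus 1, so no inverse has to be
    expanded. *)
Lemma phi_comm_expand k l x y A B :
  phi x = 1 + hvar ^+ k *: A -> phi y = 1 + hvar ^+ l *: B ->
  phi (mcg_comm x y) =
  1 + hvar ^+ (k + l) *: ((A * B - B * A) * (phi (x^-1)%g * phi (y^-1)%g)).
Proof.
move=> ex ey.
have e1 (a b : 'M[fps]_5) : (1 + a) * (1 + b) = (1 + a + b) + a * b.
  by rewrite mulrDr mulr1 mulrDl mul1r addrA.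
have e : phi x * phi y - phi y * phi x = hvar ^+ (k + l) *: (A * B - B * A).
  rewrite ex ey !e1 (addrAC 1 (hvar ^+ l *: B)) opprD addrACA subrr add0r.
  by rewrite -!scalerAl -!scalerAr !scalerA -!exprD (addnC l k) scalerBr.
rewrite scalerAl -e /mcg_comm !phiM mulrBl !mulrA.
rewrite -(mulrA (phi y)) phiV mulr1 phiV [RHS]addrC subrK //.
Qed.

Lemma jones_fil_comm k l x y : jones_fil k x -> jones_fil l y ->
  jones_fil (k + l) (mcg_comm x y).
Proof.
move=> fx fy; have [A ex _] := jones_fil_expand fx.
have [B ey _] := jones_fil_expand fy.
apply: jones_filI (phi_comm_expand ex ey).
exact: (torelliM (torelliM (torelliM fx.1 fy.1) (torelliV fx.1)) (torelliV fy.1)).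
Qed.

Lemma cmx0_jones_fil k x : (0 < k)%N -> jones_fil k x -> cmx 0 (phi x) = 1.
Proof.
move=> k0 [_ /hfilP/(_ _ k0)]; rewrite cmxB cmx0_1 => /eqP.
by rewrite subr_eq0 => /eqP.
Qed.

Lemma lead_comm k l x y : (0 < k)%N -> (0 < l)%N ->
  jones_fil k x -> jones_fil l y ->
  lead (k + l) (mcg_comm x y) = lead k x * lead l y - lead l y * lead k x.
Proof.
move=> k0 l0 fx fy; have [A ex ->] := jones_fil_expand fx.
have [B ey ->] := jones_fil_expand fy.
rewrite (lead_expand (phi_comm_expand ex ey)) cmx0M cmxB !cmx0M.
rewrite (cmx0_jones_fil k0 (jones_filV fx)) (cmx0_jones_fil l0 (jones_filV fy)).
by rewrite !mulr1.
Qed.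

(** * Symmetry and trace of the leading coefficients *)

Definition imx n (s : seq (seq int)) : 'M[rat]_n :=
  \matrix_(i, j) (nth 0 (nth [::] s i) j)%:~R.

(** The value at h = 0, that is at q = -1, of the hermitian form itself; the extra factor q in
    [herm] accounts for the sign in [herm0]. *)
Definition Jform : 'M[rat]_5 := imx 5
  [:: [:: 0; 0; 2; 0; 0]; [:: 0; -1; 0; 1; 1]; [:: 2; 0; 0; 0; 0];
      [:: 0; 1; 0; -1; 1]; [:: 0; 1; 0; 1; -1]].

(* Twice the inverse of Jform *)
Definition Jdual : 'M[rat]_5 := imx 5
  [:: [:: 0; 0; 1; 0; 0]; [:: 0; 0; 0; 1; 1]; [:: 1; 0; 0; 0; 0];
      [:: 0; 1; 0; 0; 1]; [:: 0; 1; 0; 1; 0]].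

Definition const_rows (s : seq (seq int)) : pmx :=
  [seq [seq [:: c] | c <- r] | r <- s].

Lemma imxE n s : imx n s = pmxev 0 n (const_rows s).
Proof.
apply/matrixP => i j; rewrite !mxE /pcoef /const_rows.
case: (ltnP i (size s)) => si; last first.
  by rewrite (nth_default _ si) (@nth_default _ _ (map _ _)) ?size_map // !nth_nil.
rewrite (nth_map [::]) //.
case: (ltnP j (size (nth [::] s i))) => sj.
  by rewrite (nth_map 0) //= mul0r addr0.
by rewrite (nth_default _ sj) (@nth_default _ _ (map _ _)) ?size_map.
Qed.

Lemma herm0 : cmx 0 herm = - Jform.
Proof.
transitivity (pmxev (fps_at0 (- expfps 5)) 5 herm_rows).
  exact: (pmxev_rmorph fps_at0).
have -> : fps_at0 (- expfps 5) = -1 by rewrite rmorphN /= /fps_at0 expfps_at0.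
apply/matrixP => i j; rewrite !mxE.
by case: i => -[|[|[|[|[|]]]]] //= ?; case: j => -[|[|[|[|[|]]]]] //= ?; lra.
Qed.

Lemma hvarX_at0 k : (0 < k)%N -> fps_at0 (hvar ^+ k) = 0.
Proof. by case: k => // k _; rewrite exprS rmorphM mul0r. Qed.

(** Compare the coefficients of h^k in the invariance of [herm]: the conjugation turns h^k A into
    (-1)^k h^k times the conjugate of A, so that (-1)^k A^T J + J A = 0 at h = 0. *)
Lemma lead_adj k x : (0 < k)%N -> jones_fil k x ->
  (lead k x)^T * Jform = (-1) ^+ k.+1 *: (Jform * lead k x).
Proof.
move=> k0 fx; have [A ex ->] := jones_fil_expand fx.
have := phi_herm x; rewrite ex; set s := (-1) ^+ k : fps.
have -> : (barmx (1 + hvar ^+ k *: A))^T = 1 + hvar ^+ k *: (s *: (barmx A)^T).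
  rewrite /barmx map_mxD map_mx1 map_mxZ rmorphXn /= fps_bar_hvar exprNn -/s.
  by rewrite linearD /= trmx1 linearZ /= scalerA mulrC.
rewrite mulrDl mul1r mulrDl !mulrDr !mulr1 -addrA => /(canRL (addKr _)).
rewrite addNr -!scalerAl -!scalerAr -!scalerDr -[RHS](scaler0 _ (hvar ^+ k)).
move/hvarXZ_inj/(congr1 (cmx 0)).
have cZ (a : fps) M : cmx 0 (a *: M) = fps_at0 a *: cmx 0 M.
  exact: (map_mxZ fps_at0).
have cB : cmx 0 (barmx A)^T = (cmx 0 A)^T.
  by apply/matrixP => i j; rewrite !mxE /fcoef /fps_bar expr0 mul1r.
rewrite cmxD cZ cmxD cZ !cmx0M cB herm0 hvarX_at0 // scale0r addr0 mulNr mulrN.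
rewrite rmorphXn rmorphN rmorph1 /=.
rewrite /cmx map_mx0 => /eqP; rewrite scalerN -opprD oppr_eq0 addr_eq0 => /eqP ->.
rewrite exprS mulN1r scaleNr scalerN opprK scalerA -exprD addnn -signr_odd.
by rewrite odd_double expr0 scale1r.
Qed.

(* xi is a product of five conjugates of zeta_1, and xi^6 = 1. *)
Lemma det_phi x : \det (phi x) ^+ 30 = 1.
Proof.
elim/mcg_ind: x => [|x y ex ey|x ex|i].
- by rewrite phi1 det1 expr1n.
- by rewrite phiM det_mulmx exprMn ex ey mulr1.
- by rewrite -[LHS]mul1r -ex -exprMn -det_mulmx mulmxE phiV det1 expr1n.
have dzeta j : \det (jones_zeta j) = \det jones_zeta1.
  rewrite /jones_zeta !det_mulmx mulrAC -det_mulmx mulmxE divrr ?unitrX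
    ?jones_xi_unit //.
  by rewrite det1 mul1r.
have dM (A B : 'M[laurent]_5) : \det (A * B) = \det A * \det B by exact: det_mulmx.
have dxi : \det jones_xi = \det jones_zeta1 ^+ 5.
  rewrite -jones_prod (big_morph (fun A : 'M[laurent]_5 => \det A) dM (det1 _ _)).
  by rewrite (eq_bigr _ (fun j _ => dzeta j)) /chain5 !big_cons big_nil mulr1
    !exprS expr0 mulr1.
have d1 : \det (jones_xi ^+ 6) = 1 by rewrite jones_xi6 det1.
rewrite !exprS expr0 mulr1 !dM dxi -!exprD in d1.
rewrite /phi rho_of weval_z det_map_mx dzeta -rmorphXn -[RHS](rmorph1 subst_exp).
by congr (_ _); rewrite -d1.
Qed.

(** The determinant of 1 + h^k A is 1 + h^k tr A modulo h^(k+1). Its 30th power is 1, which forces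
    30 tr A = 0 at h = 0. *)
Lemma lead_tr k x : (0 < k)%N -> jones_fil k x -> \tr (lead k x) = 0.
Proof.
move=> k0 fx; have [A ex ->] := jones_fil_expand fx.
have prod1 (s : seq 'I_5) : exists2 g, \prod_(i <- s) (1 + hvar ^+ k * A i i)
    = 1 + hvar ^+ k * g & fps_at0 g = \sum_(i <- s) cmx 0 A i i.
  elim: s => [|i s [g eg g0]]; first by exists 0; rewrite ?big_nil ?mulr0 ?addr0.
  exists (A i i + g + hvar ^+ k * (A i i * g)).
    by rewrite big_cons eg; ring.
  by rewrite big_cons !rmorphD rmorphM /= g0 hvarX_at0 // mul0r addr0 mxE.
(* A permutation that moves i also moves s(i), which gives two off-diagonal factors, each divisible
   by h^k. *)
have offdiag (s : 'S_5) : s != 1%g ->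
    exists g, (-1) ^+ s * \prod_i (phi x) i (s i) = hvar ^+ k * (hvar ^+ k * g).
  move=> s1; have [i si] : exists i, s i != i.
    apply/existsP; apply: contraNT s1; rewrite negb_exists => /forallP s1.
    by apply/eqP/permP => i; rewrite perm1; apply/eqP; have := s1 i; rewrite negbK.
  rewrite (bigD1 i) // (bigD1 (s i)) //= ex !mxE /=.
  rewrite eq_sym (negPf si) eq_sym (inj_eq perm_inj) (negPf si) !add0r.
  set p := \prod_(_ | _) _; set e := (-1) ^+ s.
  set a := A i (s i); set b := A (s i) (s (s i)); clearbody p e a b.
  by exists (e * (a * b * p)); ring.
have [g eg g0] : exists2 g, \det (phi x) = 1 + hvar ^+ k * g & fps_at0 g = \tr
  (cmx 0 A).
  have [g eg g0] := prod1 (index_enum 'I_5).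
  have [r er] : exists r, \sum_(s : 'S_5 | s != 1%g) (-1) ^+ s * \prod_i (phi
    x) i (s i)
      = hvar ^+ k * (hvar ^+ k * r).
    elim/big_ind: _ => [|_ _ [r ->] [r' ->]|s]; last exact: offdiag.
      by exists 0; rewrite !mulr0.
    by exists (r + r'); rewrite !mulrDr.
  exists (g + hvar ^+ k * r); last by rewrite rmorphD rmorphM /= g0 hvarX_at0
    // mul0r addr0.
  rewrite /determinant (bigD1 (1%g : {perm 'I_5})) //= odd_perm1 mul1r er
    mulrDr addrA -eg.
  by congr (_ + _); apply: eq_bigr => i _; rewrite perm1 ex !mxE eqxx.
have d30 := det_phi x.
have [r er] : exists r, (1 + hvar ^+ k * g) ^+ 30 = 1 + hvar ^+ k * (g *+ 30 +
  hvar ^+ k * r).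
  elim: 30%N => [|n [r er]]; first by exists 0; rewrite expr0; ring.
  by exists (r + g * (g *+ n + hvar ^+ k * r)); rewrite exprS er mulrS; ring.
move: d30; rewrite eg er -[RHS]addr0 => /addrI; rewrite -[RHS](mulr0 (hvar ^+ k)).
move/hvarX_inj/(congr1 fps_at0).
rewrite rmorphD rmorphMn rmorphM /= g0 hvarX_at0 // mul0r addr0 rmorph0.
by move=> /eqP; rewrite mulrn_eq0 => /eqP.
Qed.

(** * Linear maps on (A / B) (x) Q *)

Section QuotQLift.
Variables (G : groupType) (A B : G -> Prop) (W : lmodType rat) (L : G -> W).
Hypothesis A1 : A 1%g.
Hypothesis AM : forall x y, A x -> A y -> A (x * y)%g.
Hypothesis AV : forall x, A x -> A (x^-1)%g.
Hypothesis LM : forall x y, A x -> A y -> L (x * y)%g = L x + L y.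
Hypothesis BE : forall x, A x -> (B x <-> L x = 0).

Lemma membP (x : memb A) : A (val x).
Proof. exact/asboolP/(valP x). Qed.

Definition mkmemb (x : G) (Ax : A x) : memb A := exist _ x (asboolT Ax).

Definition quotQ_lift_sum (s : formal_sum A) : W := \sum_(p <- s) p.2 *: L (val
  p.1).

Lemma quotQ_lift_sum_tens s t : tens_eq B s t -> quotQ_lift_sum s =
  quotQ_lift_sum t.
Proof.
rewrite /quotQ_lift_sum; elim=> {s t} //.
- by move=> s t u _ -> _ ->.
- by move=> s s' t t' _ e _ e'; rewrite !big_cat /= e e'.
- by move=> s t; rewrite !big_cat /= addrC.
- move=> x y z c e; rewrite !big_cons !big_nil /= !addr0 e -scalerDr LM //.
    exact: membP.
  exact: membP.
- by move=> x c d; rewrite !big_cons !big_nil /= !addr0 scalerDl.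
- by move=> x; rewrite big_cons big_nil scale0r addr0.
- move=> x c /BE L0; rewrite big_cons big_nil /= L0 ?scaler0 ?addr0 //.
  exact: membP.
Qed.

Definition quotQ_lift (v : quotQ A B) : W := quotQ_lift_sum (repr v).

Lemma quotQ_liftE s : quotQ_lift (quotQ_of B s) = quotQ_lift_sum s.
Proof. exact/quotQ_lift_sum_tens/quotQ_reprE. Qed.

Lemma quotQ_lift_tens (x : memb A) c : quotQ_lift (tens B x c) = c *: L (val x).
Proof. by rewrite quotQ_liftE /quotQ_lift_sum big_seq1. Qed.

Lemma quotQ_lift_is_linear : linear quotQ_lift.
Proof.
move=> c u v; rewrite -(quotQ_repr u) -(quotQ_repr v).
rewrite [X in X + _]quotQ_scaleE [X in quotQ_lift X]quotQ_addE !quotQ_liftE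
  /quotQ_lift_sum big_cat /=.
rewrite /fscale big_map scaler_sumr; congr (_ + _).
by apply: eq_bigr => p _; rewrite scalerA.
Qed.
HB.instance Definition _ := GRing.isLinear.Build rat (quotQ A B) W _ quotQ_lift
  quotQ_lift_is_linear.

Lemma tens_scale (x : memb A) c d : c *: tens B x d = tens B x (c * d).
Proof. exact: quotQ_scaleE. Qed.

Lemma tensM (x y z : memb A) c : val z = (val x * val y)%g ->
  tens B z c = tens B x c + tens B y c.
Proof.
by move=> e; rewrite [RHS]quotQ_addE; apply/quotQ_ofP/tens_mull.
Qed.

Lemma tens_int (x : memb A) (n : int) :
  exists y : memb A, tens B y 1 = n%:~R *: tens B x 1.
Proof.
have natP (m : nat) : exists y : memb A, tens B y 1 = m%:R *: tens B x 1.
  elim: m => [|m [y ey]].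
    exists (mkmemb A1); rewrite scale0r.
    apply: (addrI (tens B x 1)); rewrite addr0; symmetry.
    by apply: tensM; rewrite mulg1.
  exists (mkmemb (AM (membP x) (membP y))).
  by rewrite (@tensM x y) // ey -natr1 scalerDl scale1r addrC.
case: n => m; first exact: natP.
have [y ey] := natP m.+1; exists (mkmemb (AV (membP y))).
rewrite NegzE intrN scaleNr -[X in - X]ey; apply/eqP; rewrite -addr_eq0; apply/eqP.
have e1 : tens B (mkmemb A1) 1 = 0.
  by apply: (addrI (tens B x 1)); rewrite addr0; symmetry; apply: tensM;
    rewrite mulg1.
by rewrite -(@tensM _ _ (mkmemb A1)) //= mulVg.
Qed.

(** Over a common denominator N the coefficients become integers, and these are absorbed into the
    group elements, which are then multiplied. *)
Lemma quotQ_tensP (v : quotQ A B) : exists c x, v = tens B x c.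
Proof.
rewrite -(quotQ_repr v); elim: (repr v) => [|[x c] s [d [y e]]].
  exists 0, (mkmemb A1); apply/quotQ_ofP/tens_sym/tens_zero.
have -> : quotQ_of B ((x, c) :: s) = tens B x c + tens B y d.
  by rewrite -e [RHS]quotQ_addE.
have n0 (q : rat) : (denq q)%:~R != 0 :> rat by rewrite intr_eq0 denq_eq0.
pose N : rat := (denq c)%:~R * (denq d)%:~R.
have [x' ex] := tens_int x (numq c * denq d).
have [y' ey] := tens_int y (numq d * denq c).
pose z := mkmemb (AM (membP x') (membP y')).
have ez : tens B z 1 = tens B x' 1 + tens B y' 1 by apply: tensM.
exists N^-1, z; rewrite -[in RHS](mulr1 N^-1) -[RHS]tens_scale ez ex ey scalerDr.
rewrite !scalerA !tens_scale !mulr1 !intrM /N.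
rewrite -{1}(divq_num_den c) -{1}(divq_num_den d).
congr (tens _ _ _ + tens _ _ _); field; rewrite ?n0 //.
Qed.

(** On a pure tensor this is [BE]: c L(x) = 0 forces c = 0 or x in B. *)
Lemma quotQ_lift_inj : injective quotQ_lift.
Proof.
move=> u v e; apply/eqP; rewrite -subr_eq0; apply/eqP.
have : quotQ_lift (u - v) = 0 by rewrite linearB /= e subrr.
have [c [x ->]] := quotQ_tensP (u - v).
rewrite quotQ_lift_tens => /eqP; rewrite scaler_eq0 => /orP[/eqP->|/eqP/BE Bx].
  by apply/quotQ_ofP/tens_zero.
by apply/quotQ_ofP/tens_quot/Bx/membP.
Qed.

End QuotQLift.

(** * The primitive part of the exterior square *)

Lemma ord4P (P : 'I_4 -> Prop) :
  P (o4 0) -> P (o4 1) -> P (o4 2) -> P (o4 3) -> forall i, P i.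
Proof.
move=> P0 P1 P2 P3 [[|[|[|[|]]]] //= p];
  by rewrite (bool_irrelevance p isT).
Qed.

Lemma ord5P (P : 'I_5 -> Prop) :
  P (o5 0) -> P (o5 1) -> P (o5 2) -> P (o5 3) -> P (o5 4) -> forall i, P i.
Proof.
move=> P0 P1 P2 P3 P4 [[|[|[|[|[|]]]]] //= p];
  by rewrite (bool_irrelevance p isT).
Qed.

Lemma sum4 (V : nmodType) (F : 'I_4 -> V) :
  \sum_i F i = F (o4 0) + F (o4 1) + F (o4 2) + F (o4 3).
Proof.
rewrite !big_ord_recl big_ord0 addr0 !addrA.
by congr (F _ + F _ + F _ + F _); apply: val_inj.
Qed.

Lemma sum5 (V : nmodType) (F : 'I_5 -> V) :
  \sum_i F i = F (o5 0) + F (o5 1) + F (o5 2) + F (o5 3) + F (o5 4).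
Proof.
rewrite !big_ord_recl big_ord0 addr0 !addrA.
by congr (F _ + F _ + F _ + F _ + F _); apply: val_inj.
Qed.

(* The basis of the primitive alternating matrices is the one in which their
   transformation law agrees up to sign with phi at h = 0. *)
Definition skmx (u : 'cV[rat]_5) : 'M[rat]_4 := \matrix_(i, j)
  nth 0 (nth [::]
    [:: [:: 0; 2 * u (o5 0) 0;
            u (o5 1) 0 - u (o5 3) 0 + u (o5 4) 0; 2 * u (o5 1) 0];
        [:: - 2 * u (o5 0) 0; 0;
            - 2 * u (o5 4) 0; - u (o5 1) 0 + u (o5 3) 0 - u (o5 4) 0];
        [:: - u (o5 1) 0 + u (o5 3) 0 - u (o5 4) 0; 2 * u (o5 4) 0;
            0; - 2 * u (o5 2) 0];
        [:: - 2 * u (o5 1) 0; u (o5 1) 0 - u (o5 3) 0 + u (o5 4) 0;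
            2 * u (o5 2) 0; 0]] i) j.

Definition skcoord (X : 'M[rat]_4) : 'cV[rat]_5 := \col_k
  nth 0 [:: - X (o4 1) (o4 0) / 2; - X (o4 3) (o4 0) / 2; X (o4 3) (o4 2) / 2;
            X (o4 2) (o4 0) - X (o4 3) (o4 0) / 2 + X (o4 2) (o4 1) / 2;
            X (o4 2) (o4 1) / 2] k.

Definition primitive (X : 'M[rat]_4) := X^T = - X /\ \tr (Om *m X) = 0.

Lemma skmxK u : skcoord (skmx u) = u.
Proof.
by apply/matrixP => k j; rewrite ord1; elim/ord5P: k;
  rewrite !mxE /= ?mxE /=; lra.
Qed.

Lemma skcoordK X : primitive X -> skmx (skcoord X) = X.
Proof.
case=> /matrixP sX; rewrite /mxtrace sum4 !mxE !sum4 !mxE /= => tX.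
have := sX (o4 0) (o4 0); have := sX (o4 1) (o4 1).
have := sX (o4 2) (o4 2); have := sX (o4 3) (o4 3).
have := sX (o4 0) (o4 1); have := sX (o4 0) (o4 2); have := sX (o4 0) (o4 3).
have := sX (o4 1) (o4 2); have := sX (o4 1) (o4 3); have := sX (o4 2) (o4 3).
rewrite !mxE => *.
by apply/matrixP => i j; elim/ord4P: i; elim/ord4P: j;
  rewrite !mxE /= ?mxE /=; lra.
Qed.

Lemma skmx_primitive u : primitive (skmx u).
Proof.
split.
  by apply/matrixP => i j; elim/ord4P: i; elim/ord4P: j;
    rewrite !mxE /=; ring.
by rewrite /mxtrace sum4 !mxE !sum4 !mxE /= /=; lra.
Qed.

Lemma mulmx_symJ (X : 'M[rat]_4) : X *m Om =
  \matrix_(i, j) nth 0 [:: - X i (o4 2); - X i (o4 3); X i (o4 0); X i (o4 1)] j.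
Proof.
by apply/matrixP => i j; elim/ord4P: j; rewrite !mxE !sum4 !mxE /=; lra.
Qed.

(** Identifies J, up to a scalar, with the form tr(X Om Y Om), whose invariance under X |-> g X g^T
    is immediate from g^T Om g = Om; [ext2_form] rests on this. *)
Lemma skmx_form u v :
  \tr (skmx u *m Om *m skmx v *m Om) = - 4 * (u^T *m Jform *m v) 0 0.
Proof.
have -> : (u^T *m Jform *m v) 0 0 = 2 * (u (o5 0) 0 * v (o5 2) 0 + u (o5 2) 0 *
  v (o5 0) 0)
   - u (o5 1) 0 * v (o5 1) 0 - u (o5 3) 0 * v (o5 3) 0 - u (o5 4) 0 * v (o5 4) 0
   + u (o5 1) 0 * (v (o5 3) 0 + v (o5 4) 0) + u (o5 3) 0 * (v (o5 1) 0 + v (o5 4) 0)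
   + u (o5 4) 0 * (v (o5 1) 0 + v (o5 3) 0).
  by rewrite !mxE sum5 !mxE !sum5 !mxE /=; ring.
have -> (X Y : 'M[rat]_4) : \tr (X *m Om *m Y *m Om) =
    X (o4 0) (o4 2) * Y (o4 0) (o4 2) + X (o4 0) (o4 3) * Y (o4 1) (o4 2)
     - X (o4 0) (o4 0) * Y (o4 2) (o4 2) - X (o4 0) (o4 1) * Y (o4 3) (o4 2)
     + X (o4 1) (o4 2) * Y (o4 0) (o4 3) + X (o4 1) (o4 3) * Y (o4 1) (o4 3)
     - X (o4 1) (o4 0) * Y (o4 2) (o4 3) - X (o4 1) (o4 1) * Y (o4 3) (o4 3)
     - X (o4 2) (o4 2) * Y (o4 0) (o4 0) - X (o4 2) (o4 3) * Y (o4 1) (o4 0)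
     + X (o4 2) (o4 0) * Y (o4 2) (o4 0) + X (o4 2) (o4 1) * Y (o4 3) (o4 0)
     - X (o4 3) (o4 2) * Y (o4 0) (o4 1) - X (o4 3) (o4 3) * Y (o4 1) (o4 1)
     + X (o4 3) (o4 0) * Y (o4 2) (o4 1) + X (o4 3) (o4 1) * Y (o4 3) (o4 1).
  by rewrite -mulmxA !mulmx_symJ /mxtrace sum4 !mxE !sum4 !mxE /=; ring.
by rewrite !mxE /=; ring.
Qed.

Lemma skmx_is_linear : linear skmx.
Proof.
move=> c u v; apply/matrixP => i j.
by elim/ord4P: i; elim/ord4P: j; rewrite !mxE /=; ring.
Qed.
HB.instance Definition _ :=
  GRing.isLinear.Build rat 'cV[rat]_5 'M[rat]_4 _ skmx skmx_is_linear.

Lemma skcoord_is_linear : linear skcoord.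
Proof.
move=> c u v; apply/matrixP => i j; rewrite ord1.
by elim/ord5P: i; rewrite !mxE /= ?mxE; ring.
Qed.
HB.instance Definition _ :=
  GRing.isLinear.Build rat 'M[rat]_4 'cV[rat]_5 _ skcoord skcoord_is_linear.

(** The action X |-> g X g^T on the primitive part in the coordinates of [skmx]; its entries are
    polynomials in those of g. *)
Definition ext2 (g : 'M[rat]_4) : 'M[rat]_5 :=
  \matrix_(a, b) skcoord (g *m skmx (delta_mx b 0) *m g^T) a 0.

Lemma ext2_mul g u : ext2 g *m u = skcoord (g *m skmx u *m g^T).
Proof.
have {2}-> : u = \sum_b u b 0 *: delta_mx b 0.
  by rewrite [LHS]matrix_sum_delta; apply: eq_bigr => b _; rewrite big_ord1.
rewrite !linear_sum mulmx_suml linear_sum /=; apply/matrixP => a j.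
rewrite ord1 mxE summxE; apply: eq_bigr => b _.
by rewrite mxE !linearZ -scalemxAl linearZ !mxE mulrC.
Qed.

Lemma mulmx_cV_inj m n (A B : 'M[rat]_(m, n)) :
  (forall u : 'cV_n, A *m u = B *m u) -> A = B.
Proof.
move=> e; apply/matrixP => i j; have /matrixP/(_ i 0) := e (delta_mx j 0).
by rewrite -!colE !mxE.
Qed.

Lemma symplecticM (g h : 'M[rat]_4) :
  is_symplectic g -> is_symplectic h -> is_symplectic (g * h).
Proof.
move=> /eqP sg /eqP sh; apply/eqP; rewrite trmx_mul.
by rewrite -!mulmxA (mulmxA Om) (mulmxA g^T) (mulmxA g^T) sg mulmxA.
Qed.

Lemma primitive_act g X : is_symplectic g -> primitive X ->
  primitive (g *m X *m g^T).
Proof.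
move=> /eqP sg [sX tX]; split.
  by rewrite !trmx_mul trmxK sX mulNmx mulmxN mulmxA.
rewrite mxtrace_mulC -!mulmxA mxtrace_mulC -!mulmxA (mulmxA g^T) sg.
by rewrite mxtrace_mulC.
Qed.

Lemma ext2M g h : is_symplectic h -> ext2 (g * h) = ext2 g * ext2 h.
Proof.
move=> sh; apply: mulmx_cV_inj => u; rewrite -mulmxE -mulmxA !ext2_mul.
rewrite skcoordK; last exact/primitive_act/skmx_primitive.
by rewrite trmx_mul !mulmxA.
Qed.

Lemma ext2_1 : ext2 1 = 1.
Proof.
by apply: mulmx_cV_inj => u; rewrite ext2_mul trmx1 mulmx1 !mul1mx skmxK.
Qed.

Lemma ext2_form g : is_symplectic g -> (ext2 g)^T *m Jform *m ext2 g = Jform.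
Proof.
move=> sg; have gJ (u v : 'cV_5) : ((ext2 g *m u)^T *m Jform *m (ext2 g *m v)) 0 0
    = (u^T *m Jform *m v) 0 0.
  have := skmx_form (ext2 g *m u) (ext2 g *m v); have := skmx_form u v.
  rewrite !ext2_mul !skcoordK; try exact/primitive_act/skmx_primitive.
  have -> : \tr (g *m skmx u *m g^T *m Om *m (g *m skmx v *m g^T) *m Om)
      = \tr (skmx u *m Om *m skmx v *m Om).
    move/eqP: sg => sg; have sg' M : g^T *m (Om *m (g *m M)) = Om *m M.
      by rewrite !mulmxA sg.
    rewrite -!mulmxA mxtrace_mulC -!mulmxA sg' [g^T *m _]mulmxA sg.
    by rewrite !mulmxA.
  by move=> -> /mulfI ->.
have E (M : 'M[rat]_5) a b : ((delta_mx a 0 : 'cV_5)^T *m M *m (delta_mx b 0 :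
  'cV_5)) 0 0 = M a b.
  rewrite -colE !mxE (bigD1 a) //= !mxE !eqxx mul1r big1 ?addr0 // => i ia.
  by rewrite !mxE (negPf ia) mul0r.
apply/matrixP => a b; rewrite -[RHS]E -[LHS]E -gJ trmx_mul !mulmxA //.
Qed.

Lemma JformK : Jdual *m Jform = 2%:M.
Proof.
apply/matrixP => a b; elim/ord5P: a; elim/ord5P: b;
  by rewrite !mxE sum5 !mxE /=; lra.
Qed.

Lemma JformV : Jform *m Jdual = 2%:M.
Proof.
apply/matrixP => a b; elim/ord5P: a; elim/ord5P: b;
  by rewrite !mxE sum5 !mxE /=; lra.
Qed.

(** The adjoint J^-1 A^T J with respect to J, as [Jdual] is 2 J^-1. *)
Definition jadj (A : 'M[rat]_5) : 'M[rat]_5 := 2^-1 *: (Jdual * A^T * Jform).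

Lemma jadj_is_linear : linear jadj.
Proof.
move=> c A B; rewrite /jadj linearP /= mulrDr mulrDl scalerDr -scalerAr -scalerAl.
by rewrite !scalerA mulrC.
Qed.
HB.instance Definition _ :=
  GRing.isLinear.Build rat 'M[rat]_5 'M[rat]_5 _ jadj jadj_is_linear.

Lemma JdualJ : Jdual * Jform = 2%:A.
Proof. by rewrite [LHS]JformK -scalemx1. Qed.
Lemma JJdual : Jform * Jdual = 2%:A.
Proof. by rewrite [LHS]JformV -scalemx1. Qed.

Lemma Jform_tr : Jform^T = Jform.
Proof. by apply/matrixP => a b; elim/ord5P: a; elim/ord5P: b; rewrite !mxE. Qed.
Lemma Jdual_tr : Jdual^T = Jdual.
Proof. by apply/matrixP => a b; elim/ord5P: a; elim/ord5P: b; rewrite !mxE. Qed.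

Lemma trmxM (A B : 'M[rat]_5) : (A * B)^T = B^T * A^T.
Proof. exact: trmx_mul. Qed.

Lemma jadjM A B : jadj (A * B) = jadj B * jadj A.
Proof.
rewrite /jadj -scalerAl -scalerAr trmxM -!mulrA (mulrA Jform) JJdual.
by rewrite -scalerAl mul1r -!scalerAr [in RHS]scalerA mulVf // scale1r.
Qed.

Lemma jadj1 : jadj 1 = 1.
Proof. by rewrite /jadj trmx1 mulr1 JdualJ scalerA mulVf ?scale1r. Qed.

Lemma jadjK : involutive jadj.
Proof.
move=> A; rewrite /jadj linearZ /= !trmxM trmxK Jdual_tr Jform_tr -scalerAr
  -scalerAl.
rewrite -!mulrA JdualJ -!scalerAr mulr1 (mulrA Jdual) JdualJ -scalerAl mul1r.
by rewrite !scalerA -[RHS]scale1r; congr (_ *: _); lra.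
Qed.

Lemma tr_jadj A : \tr (jadj A) = \tr A.
Proof.
rewrite /jadj mxtraceZ mxtrace_mulC mulmxE mulrA JJdual -scalerAl mul1r mxtraceZ.
by rewrite mxtrace_tr mulrA mulVf ?mul1r.
Qed.

Lemma trM_jadj A B : \tr (jadj A * B) = \tr (A * jadj B).
Proof. by rewrite -tr_jadj jadjM jadjK mxtrace_mulC. Qed.

(* Target of the leading coefficients of order k: skew for k even, symmetric
   and traceless for k odd. *)
Definition inK (k : nat) (A : 'M[rat]_5) : Prop :=
  jadj A = (-1) ^+ k.+1 *: A /\ \tr A = 0.

Lemma lead_inK k x : (0 < k)%N -> jones_fil k x -> inK k (lead k x).
Proof.
move=> k0 fx; split; last exact: lead_tr.
rewrite /jadj -mulrA lead_adj // -scalerAr mulrA JdualJ -scalerAl mul1r.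
by rewrite !scalerA mulrAC mulVf // mul1r.
Qed.

Lemma inKD k c A B : inK k A -> inK k B -> inK k (c *: A + B).
Proof.
move=> [aA tA] [aB tB]; split; last by rewrite linearP /= tA tB mulr0 addr0.
by rewrite linearP /= aA aB scalerDr !scalerA mulrC.
Qed.

(** For symplectic g the adjoint of [ext2 g] is its inverse, so this is conjugation by [ext2 g].
    Written with the adjoint it is visibly polynomial in g. *)
Definition ConjA (g : 'M[rat]_4) (A : 'M[rat]_5) : 'M[rat]_5 :=
  ext2 g * A * jadj (ext2 g).

Lemma ConjA_is_linear g : linear (ConjA g).
Proof. by move=> c A B; rewrite /ConjA mulrDr mulrDl -(scalerAr c) -(scalerAl
  c). Qed.
HB.instance Definition _ g :=
  GRing.isLinear.Build rat 'M[rat]_5 'M[rat]_5 _ (ConjA g) (ConjA_is_linear g).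

Lemma jadj_ext2 g : is_symplectic g -> jadj (ext2 g) * ext2 g = 1.
Proof.
move=> sg; rewrite /jadj -scalerAl -!mulrA [X in Jdual * X]mulrA.
by rewrite [X in Jdual * X](ext2_form sg) JdualJ scalerA mulVf ?scale1r.
Qed.

Lemma ext2_jadj g : is_symplectic g -> ext2 g * jadj (ext2 g) = 1.
Proof. by move=> sg; apply: mulmx1C; apply: jadj_ext2. Qed.

Lemma ConjA_M g h A : is_symplectic h -> ConjA (g * h) A = ConjA g (ConjA h A).
Proof. by move=> sh; rewrite /ConjA ext2M // jadjM !mulrA. Qed.

Lemma ConjA_1 A : ConjA 1 A = A.
Proof. by rewrite /ConjA ext2_1 jadj1 mul1r mulr1. Qed.

Lemma ConjA_inK g k A : is_symplectic g -> inK k A -> inK k (ConjA g A).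
Proof.
move=> sg [aA tA]; split.
  by rewrite /ConjA !jadjM jadjK aA -scalerAl -scalerAr mulrA.
by rewrite /ConjA -mulrA mxtrace_mulC mulmxE -mulrA jadj_ext2 // mulr1.
Qed.

(** * Comparison of phi at h = 0 with the exterior square *)

Definition omegaQ (m : mcg) : 'M[rat]_4 := map_mx intr (omega m).

Lemma omegaQ_symplectic m : is_symplectic (omegaQ m).
Proof.
have /eqP e := omega_symplectic m; apply/eqP; rewrite /omegaQ.
have -> : Om = map_mx intr (symJ int).
  by apply/matrixP => i j; rewrite !mxE rmorphB /= !rmorph_nat.
have -> : (map_mx intr (omega m))^T = map_mx intr (omega m)^T :> 'M[rat]_4.
  by apply/matrixP => i j; rewrite !mxE.
by rewrite -!map_mxM e.
Qed.

Lemma omegaQM m n : omegaQ (m * n)%g = omegaQ m * omegaQ n.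
Proof. by rewrite /omegaQ omegaM; apply: map_mxM. Qed.
Lemma omegaQ1 : omegaQ 1%g = 1.
Proof. by rewrite /omegaQ omega1; apply: map_mx1. Qed.

(** The nilpotent parts of the Dehn twists: the i-th twist acts on the primitive part by 1 + N_i
    ([ext2_zeta]), and N_i^2 = 0 ([Nmx_sq]). *)
Definition N_rows (i : nat) : seq (seq int) := nth [::]
  [:: [:: [:: 0; 0; 0; 0; 1]; [:: 0; 0; -1; 0; 0]; [:: 0; 0; 0; 0; 0];
          [:: 0; 0; -1; 0; 0]; [:: 0; 0; 0; 0; 0]];
      [:: [:: 0; 0; 0; 0; 0]; [:: 0; 0; 0; 0; 0]; [:: 0; 1; 0; 0; 0];
          [:: -1; 0; 0; 0; 0]; [:: -1; 0; 0; 0; 0]];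
      [:: [:: 0; 0; 0; 1; 0]; [:: 0; 0; -1; 0; 0]; [:: 0; 0; 0; 0; 0];
          [:: 0; 0; 0; 0; 0]; [:: 0; 0; -1; 0; 0]];
      [:: [:: 0; 0; 0; 0; 0]; [:: -1; 0; 0; 0; 0]; [:: 0; 0; 0; 0; 1];
          [:: -1; 0; 0; 0; 0]; [:: 0; 0; 0; 0; 0]];
      [:: [:: 0; 1; 0; 0; 0]; [:: 0; 0; 0; 0; 0]; [:: 0; 0; 0; 0; 0];
          [:: 0; 0; -1; 0; 0]; [:: 0; 0; -1; 0; 0]]] i.

Definition Nmx (i : nat) : 'M[rat]_5 := imx 5 (N_rows i).

Lemma phi_zeta_at0 i : cmx 0 (phi (zeta i)) = - (1 + Nmx i).
Proof.
apply/matrixP => a b; rewrite [LHS]mxE phi_zetaE.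
have -> : fcoef 0 ((jpair i a b false)%:~R * expfps (- 2)
    - (jpair i a b true)%:~R * expfps 3)
  = (jpair i a b false)%:~R - (jpair i a b true)%:~R.
  rewrite [LHS](rmorphB fps_at0) !rmorphM !rmorph_int /= /fps_at0 !expfps_at0.
  by rewrite !mulr1.
rewrite !mxE -intrB.
have -> : (a == b)%:R = ((a == b)%:R : int)%:~R :> rat by rewrite rmorph_nat.
rewrite -intrD -intrN; congr (_%:~R).
by elim/ord5P: i; elim/ord5P: a; elim/ord5P: b.
Qed.

Definition pmx_tr n (r : pmx) : pmx := mkseq (fun i => mkseq (fun j => pcoef r
  j i) n) n.

Lemma pmxev_tr (A : comNzRingType) (q : A) n r : (pmxev q n r)^T = pmxev q n
  (pmx_tr n r).
Proof. by apply/matrixP => i j; rewrite !mxE pcoef_mkseq. Qed.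

Definition pmx_comb n (s : seq (int * pmx)) : pmx :=
  mkseq (fun i => mkseq (fun j =>
    foldr (fun p acc => padd (pscale p.1 (pcoef p.2 i j)) acc) [::] s) n) n.

Lemma pmxev_comb (A : comNzRingType) (q : A) n s :
  pmxev q n (pmx_comb n s) = \sum_(p <- s) p.1%:~R *: pmxev q n p.2.
Proof.
apply/matrixP => i j; rewrite mxE pcoef_mkseq summxE.
elim: s => [|p s IH]; rewrite ?big_nil // big_cons -IH /=.
by rewrite pev_add pev_scale !mxE.
Qed.

Definition sk_rows (k : nat) : pmx := const_rows (nth [::]
  [:: [:: [:: 0; 2; 0; 0]; [:: -2; 0; 0; 0]; [:: 0; 0; 0; 0]; [:: 0; 0; 0; 0]];
      [:: [:: 0; 0; 1; 2]; [:: 0; 0; 0; -1]; [:: -1; 0; 0; 0]; [:: -2; 1; 0; 0]];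
      [:: [:: 0; 0; 0; 0]; [:: 0; 0; 0; 0]; [:: 0; 0; 0; -2]; [:: 0; 0; 2; 0]];
      [:: [:: 0; 0; -1; 0]; [:: 0; 0; 0; 1]; [:: 1; 0; 0; 0]; [:: 0; -1; 0; 0]];
      [:: [:: 0; 0; 1; 0]; [:: 0; 0; -2; -1]; [:: -1; 2; 0; 0]; [:: 0; 1; 0;
        0]]] k).

Lemma skmx_delta (k : 'I_5) : skmx (delta_mx k 0) = pmxev 0 4 (sk_rows k).
Proof.
rewrite -imxE; apply/matrixP => i j.
by elim/ord5P: k; elim/ord4P: i; elim/ord4P: j; rewrite !mxE /= ?mxE /=; lra.
Qed.

Lemma ext2_zeta i : ext2 (omegaQ (zeta i)) = 1 + Nmx i.
Proof.
have T : omegaQ (zeta i) = pmxev 0 4 (tv_rows 1 i).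
  rewrite /omegaQ omega_zeta; have /= -> := twistE i.
  by rewrite (pmxev_rmorph intr).
apply/matrixP => a b; rewrite [LHS]mxE T skmx_delta pmxev_tr !pmxevM.
(* Column b: T X_b T^T is the combination of the basis matrices X_k whose coefficients form column b
   of 1 + N_i, an identity between integer matrices. *)
have -> : pmxev (0 : rat) 4 (pmx_mul 4 (pmx_mul 4 (tv_rows 1 i) (sk_rows b))
      (pmx_tr 4 (tv_rows 1 i)))
    = pmxev 0 4 (pmx_comb 4 [seq ((k == b)%:Z + nth 0 (nth [::] (N_rows i) k) b,
                                 sk_rows k) | k : 'I_5 <- chain5]).
  by apply: pmxev_eq; rewrite {T}; elim/ord5P: i; elim/ord5P: b; vm_compute.
rewrite pmxev_comb linear_sum summxE big_map.
under eq_bigr => k _ do rewrite linearZ /= -skmx_delta skmxK !mxE.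
rewrite /chain5 !big_cons big_nil !mxE.
elim/ord5P: a; rewrite /= ?mulr0 ?addr0 ?add0r mulr1 intrD; congr (_ + _).
Qed.

(** Every twist contributes a sign -1; since e * e = 1, the sign cancels under conjugation. *)
Lemma phi_at0 m :
  exists2 e : rat, e * e = 1 & cmx 0 (phi m) = e *: ext2 (omegaQ m).
Proof.
elim/mcg_ind: m => [|x y [e ee ex] [d dd ey]|x [e ee ex]|i].
- by exists 1; rewrite ?mulr1 // phi1 cmx0_1 omegaQ1 ext2_1 scale1r.
- exists (e * d); first by rewrite mulrACA ee dd mulr1.
  rewrite phiM cmx0M ex ey omegaQM ext2M ?omegaQ_symplectic //.
  by rewrite -(scalerAl e) -(scalerAr d) scalerA.
- exists e => //; set R := ext2 _.
  have RR : cmx 0 (phi x) * (e *: R) = 1.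
    rewrite ex -(scalerAl e) -(scalerAr e) scalerA ee scale1r.
    by rewrite -ext2M ?omegaQ_symplectic // -omegaQM mulgV omegaQ1 ext2_1.
  by rewrite -[LHS]mulr1 -RR mulrA -cmx0M phiVx cmx0_1 mul1r.
- by exists (- 1); rewrite ?mulrNN ?mulr1 // phi_zeta_at0 ext2_zeta scaleN1r.
Qed.

Lemma lead_ConjA k m x : jones_fil k x ->
  lead k (m * x * m^-1)%g = ConjA (omegaQ m) (lead k x).
Proof.
move=> fx; rewrite lead_conj // /ConjA; have [e ee em] := phi_at0 m.
have RR : cmx 0 (phi m) * (e *: jadj (ext2 (omegaQ m))) = 1.
  rewrite em -(scalerAl e) -(scalerAr e) scalerA ee scale1r.
  by rewrite ext2_jadj ?omegaQ_symplectic.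
have -> : cmx 0 (phi (m^-1)%g) = e *: jadj (ext2 (omegaQ m)).
  by rewrite -[LHS]mulr1 -RR mulrA -cmx0M phiVx cmx0_1 mul1r.
by rewrite em -(scalerAr e) -!(scalerAl e) scalerA ee scale1r.
Qed.

(** * Irreducibility *)

Definition ad (i : nat) (A : 'M[rat]_5) : 'M[rat]_5 := Nmx i * A - A * Nmx i.

Lemma Nmx_sq (i : 'I_5) : Nmx i * Nmx i = 0.
Proof.
have -> : 0 = pmxev 0 5 [::] :> 'M[rat]_5.
  by apply/matrixP => a b; rewrite !mxE /pcoef !nth_nil.
rewrite /Nmx imxE pmxM; apply: pmxev_eq.
by elim/ord5P: i; vm_compute.
Qed.

(** The isometry 1 + N of J has inverse 1 - N, and the inverse of an isometry is its adjoint. *)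
Lemma jadj_Nmx (i : 'I_5) : jadj (Nmx i) = - Nmx i.
Proof.
have s := jadj_ext2 (omegaQ_symplectic (zeta i)); rewrite ext2_zeta in s.
have e : (1 - Nmx i) * (1 + Nmx i) = 1.
  by rewrite mulrBl mul1r mulrDr mulr1 Nmx_sq addr0 addrK.
have e' : (1 + Nmx i) * (1 - Nmx i) = 1.
  by rewrite mulrDl mul1r mulrBr mulr1 Nmx_sq subr0 subrK.
have : jadj (1 + Nmx i) = 1 - Nmx i.
  transitivity (jadj (1 + Nmx i) * ((1 + Nmx i) * (1 - Nmx i))).
    by rewrite e' mulr1.
  by rewrite mulrA s mul1r.
by rewrite linearD /= jadj1 => /addrI.
Qed.

Lemma ConjA_zeta (i : 'I_5) A :
  ConjA (omegaQ (zeta i)) A = (1 + Nmx i) * A * (1 - Nmx i).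
Proof. by rewrite /ConjA ext2_zeta linearD /= jadj1 jadj_Nmx. Qed.

Lemma ext2_zetaV (i : 'I_5) : ext2 (omegaQ ((zeta i)^-1)%g) = 1 - Nmx i.
Proof.
have e : ext2 (omegaQ ((zeta i)^-1)%g) * (1 + Nmx i) = 1.
  by rewrite -ext2_zeta -ext2M ?omegaQ_symplectic // -omegaQM mulVg omegaQ1 ext2_1.
have e' : (1 + Nmx i) * (1 - Nmx i) = 1.
  by rewrite mulrDl mul1r mulrBr mulr1 Nmx_sq subr0 subrK.
transitivity (ext2 (omegaQ ((zeta i)^-1)%g) * ((1 + Nmx i) * (1 - Nmx i))).
  by rewrite e' mulr1.
by rewrite mulrA e mul1r.
Qed.

Lemma ConjA_zetaV (i : 'I_5) A :
  ConjA (omegaQ ((zeta i)^-1)%g) A = (1 - Nmx i) * A * (1 + Nmx i).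
Proof. by rewrite /ConjA ext2_zetaV linearB /= jadj1 jadj_Nmx opprK. Qed.

Section MCGSubmodule.
Variable W : 'M[rat]_5 -> Prop.
Hypothesis WD : forall c A B, W A -> W B -> W (c *: A + B).
Hypothesis WC : forall m A, W A -> W (ConjA (omegaQ m) A).

Lemma mcgsub0 A : W A -> W 0.
Proof. by move=> wA; have := WD (-1) wA wA; rewrite scaleN1r addNr. Qed.

Lemma mcgsubZ c A : W A -> W (c *: A).
Proof. by move=> wA; have := WD c wA (mcgsub0 wA); rewrite addr0. Qed.

Lemma mcgsubD A B : W A -> W B -> W (A + B).
Proof. by move=> wA wB; have := WD 1 wA wB; rewrite scale1r. Qed.

(** As N^2 = 0, conjugation by the twist and by its inverse gives A + [N, A] - N A N and A - [N, A]
    - N A N. Half the difference is [N, A]; A minus half the sum is N A N, as used in the next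
    lemma. *)
Lemma mcgsub_ad (i : 'I_5) A : W A -> W (ad i A).
Proof.
move=> wA; have -> : ad i A = 2^-1 *: (ConjA (omegaQ (zeta i)) A
    + (- 1) *: ConjA (omegaQ ((zeta i)^-1)%g) A).
  rewrite ConjA_zeta ConjA_zetaV scaleN1r /ad; set N := Nmx i.
  apply: (@scalerI _ _ (2 : rat)) => //; rewrite scalerA mulfV // scale1r.
  rewrite !(mulrDl, mulrDr, mulrN, mulNr, mul1r, mulr1) ?opprD ?opprK.
  move: (N * A * N) (N * A) (A * N) => P Q S.
  by apply/matrixP => a b; rewrite !mxE; ring.
by apply/mcgsubZ/mcgsubD/mcgsubZ; apply: WC.
Qed.

Lemma mcgsub_sandwich (i : 'I_5) A : W A -> W (Nmx i * A * Nmx i).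
Proof.
move=> wA; have -> : Nmx i * A * Nmx i = A + (- 2^-1) *: (ConjA (omegaQ (zeta i)) A
    + ConjA (omegaQ ((zeta i)^-1)%g) A).
  rewrite ConjA_zeta ConjA_zetaV; set N := Nmx i.
  rewrite !(mulrDl, mulrDr, mulrN, mulNr, mul1r, mulr1) ?opprD ?opprK.
  move: (N * A * N) (N * A) (A * N) => P Q S.
  by apply/matrixP => a b; rewrite !mxE; field.
by apply: mcgsubD => //; apply/mcgsubZ/mcgsubD; apply: WC.
Qed.
End MCGSubmodule.

(** * The target as the module generated by its highest weight vector *)

Definition adw (w : seq nat) (A : 'M[rat]_5) : 'M[rat]_5 := foldr ad A w.

(** Rows that are not listed read as zero, through the default values of [pcoef]. *)
Definition top_rows (odd : bool) : pmx := const_rows (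
  if odd then [:: [:: 0; 0; -1; 0; 0]] else N_rows 0).

(* Nmx 0 is a long root vector of sp(4) = so(5); Nmx 0 * Nmx 2 has rank one
   and is a highest weight vector of the traceless symmetric square. *)
Definition top (odd : bool) : 'M[rat]_5 := pmxev 0 5 (top_rows odd).

(* Words w for which the adw w (top odd) form a basis of the target; below, the
   coordinates in this basis of the projections of the delta_mx a b, in
   lexicographic order of (a, b), multiplied by 40 resp. 16. *)
Definition span_words (odd : bool) : seq (seq nat) :=
  if odd then
    [:: [::]; [:: 1]; [:: 3]; [:: 1; 1]; [:: 3; 1]; [:: 3; 3]; [:: 3; 1; 1];
    [:: 2; 3; 1]; [:: 3; 3; 1]; [:: 2; 3; 1; 1]; [:: 3; 3; 1; 1];
    [:: 3; 2; 3; 1]; [:: 3; 2; 3; 1; 1]; [:: 2; 3; 2; 3; 1; 1]]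
  else
    [:: [::]; [:: 1]; [:: 1; 1]; [:: 2; 1]; [:: 2; 1; 1]; [:: 3; 2; 1];
    [:: 2; 2; 1; 1]; [:: 3; 2; 1; 1]; [:: 3; 2; 2; 1; 1];
    [:: 3; 3; 2; 2; 1; 1]].

Definition span_coords (odd : bool) : seq (seq int) :=
  if odd then
    [:: [:: 0; 0; 0; -2; -2; -8; 0; 0; 0; -3; 0; -6; 0; -1];
    [:: 0; 20; 0; 0; 0; 0; 0; 0; 0; 0; 0; 0; 0; 0];
    [:: -40; 0; 0; 0; 0; 0; 0; 0; 0; 0; 0; 0; 0; 0];
    [:: 0; -20; -20; 0; 0; 0; 0; -20; 0; 0; 0; 0; 0; 0];
    [:: 0; 0; 20; 0; 0; 0; 0; 0; 0; 0; 0; 0; 0; 0];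
    [:: 0; 0; 0; 0; 0; 0; 10; 0; 0; 0; 0; 0; 5; 0];
    [:: 0; 0; 0; 8; -12; -8; 0; 0; 0; 2; 0; -6; 0; -1];
    [:: 0; -20; 0; 0; 0; 0; 0; -10; 0; 0; 0; 0; 0; 0];
    [:: 0; 0; 0; 0; 0; 0; 0; 0; 0; -10; 0; 0; 0; -5];
    [:: 0; 0; 0; 0; 20; 0; 0; 0; 0; 0; 0; 10; 0; 0];
    [:: 0; 0; 0; 0; 0; 0; 0; 0; 0; 0; -10; 0; 0; 0];
    [:: 0; 0; 0; 0; 0; 0; -10; 0; 0; 0; 0; 0; 0; 0];
    [:: 0; 0; 0; -2; -2; -8; 0; 0; 0; -3; 0; -6; 0; -1];
    [:: 0; 0; 0; 0; 0; 0; 10; 0; 10; 0; 0; 0; 10; 0];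
    [:: 0; 0; 0; 0; 0; 0; 0; 0; -10; 0; 0; 0; 0; 0];
    [:: 0; 0; 0; 0; 0; 0; -10; 0; -10; 0; 0; 0; -5; 0];
    [:: 0; 0; 0; -10; -10; 0; 0; 0; 0; -5; 0; 0; 0; 0];
    [:: 0; 20; 20; 0; 0; 0; 0; 10; 0; 0; 0; 0; 0; 0];
    [:: 0; 0; 0; -2; 18; 12; 0; 0; 0; 7; 0; 14; 0; 4];
    [:: 0; 0; 0; 0; -20; -20; 0; 0; 0; 0; 0; -10; 0; 0];
    [:: 0; 0; 0; 0; 0; 0; 0; 0; 10; 0; 0; 0; 5; 0];
    [:: 0; 0; 0; -10; 10; 0; 0; 0; 0; 5; 0; 0; 0; 0];
    [:: 0; 0; -20; 0; 0; 0; 0; -10; 0; 0; 0; 0; 0; 0];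
    [:: 0; 0; 0; 0; -20; -20; 0; 0; 0; 0; 0; -20; 0; -5];
    [:: 0; 0; 0; -2; -2; 12; 0; 0; 0; -3; 0; 4; 0; -1]]
  else
    [:: [:: 0; 4; 0; 0; 0; 4; 0; 0; 1; 0]; [:: 8; 0; 0; 8; 0; 0; 2; 0; 0; 0];
    [:: 0; 0; 0; 0; 0; 0; 0; 0; 0; 0]; [:: 0; 0; 0; 0; 0; 0; 2; 0; 0; 0];
    [:: 8; 0; 0; 0; 0; 0; 0; 0; 0; 0]; [:: 0; 0; 0; 0; 0; 0; 0; -2; 0; -1];
    [:: 0; 0; 0; 0; -2; -4; 0; 0; -1; 0]; [:: 0; 0; 0; 4; 0; 0; 0; 0; 0; 0];
    [:: 0; 0; 0; 0; -2; 0; 0; 0; -1; 0]; [:: 0; 0; 0; 0; 0; -4; 0; 0; 0; 0];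
    [:: 0; 0; 0; 0; 0; 0; 0; 0; 0; 0]; [:: 0; 0; 4; 0; 0; 0; 0; 0; 0; 0];
    [:: 0; -4; 0; 0; 0; -4; 0; 0; -1; 0]; [:: 0; 0; 4; 0; 0; 0; 0; 4; 0; 1];
    [:: 0; 0; 0; 0; 0; 0; 0; 0; 0; 1]; [:: 0; 0; 0; 0; 0; 0; 0; 2; 0; 0];
    [:: 0; 4; 0; 0; 2; 0; 0; 0; 0; 0]; [:: -8; 0; 0; -4; 0; 0; 0; 0; 0; 0];
    [:: 0; 4; 0; 0; 2; 4; 0; 0; 0; 0]; [:: 0; 0; 0; 0; 0; 4; 0; 0; 0; 0];
    [:: 0; 0; -4; 0; 0; 0; 0; -2; 0; 0]; [:: 0; -4; 0; 0; -2; 0; 0; 0; 0; 0];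
    [:: 0; 0; 0; -4; 0; 0; -2; 0; 0; 0]; [:: 0; 0; 0; 0; 2; 0; 0; 0; 1; 0];
    [:: 0; -4; 0; 0; 0; 0; 0; 0; 1; 0]].

Definition ad_rows (i : nat) (r : pmx) : pmx :=
  pmx_comb 5 [:: (1, pmx_mul 5 (const_rows (N_rows i)) r);
                 (-1, pmx_mul 5 r (const_rows (N_rows i)))].

Lemma ad_pmxev i r : ad i (pmxev 0 5 r) = pmxev 0 5 (ad_rows i r).
Proof.
by rewrite pmxev_comb !big_cons big_nil addr0 scale1r scaleN1r -!pmxM -imxE.
Qed.

Lemma adw_pmxev w r : adw w (pmxev 0 5 r) = pmxev 0 5 (foldr ad_rows r w).
Proof. by elim: w => //= i w ->; rewrite ad_pmxev. Qed.

(* 20 times the projection to the target. *)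
Definition prK (odd : bool) (A : 'M[rat]_5) : 'M[rat]_5 :=
  10 *: A + (5 * (-1) ^+ ~~ odd) *: (Jdual * A^T * Jform)
  - (4 * odd%:R * \tr A)%:A.

Lemma prK_is_linear odd : linear (prK odd).
Proof.
move=> c A B; rewrite /prK mxtraceD mxtraceZ.
have -> : (c *: A + B)^T = c *: A^T + B^T by apply/matrixP => i j; rewrite !mxE.
rewrite mulrDr mulrDl -(scalerAr c) -(scalerAl c) -[in RHS]mul_scalar_mx.
move: (Jdual * A^T * Jform) (Jdual * B^T * Jform) => P Q.
by apply/matrixP => a b; rewrite ?mul_scalar_mx !mxE /=; ring.
Qed.
HB.instance Definition _ odd :=
  GRing.isLinear.Build rat 'M[rat]_5 'M[rat]_5 _ (prK odd) (prK_is_linear odd).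

Lemma prK_id k A : inK k A -> prK (odd k) A = 20 *: A.
Proof.
case=> aA tA; rewrite /prK tA mulr0 scale0r subr0.
have -> : Jdual * A^T * Jform = 2 *: jadj A.
  by rewrite /jadj scalerA mulfV // scale1r.
have e : (-1) ^+ k.+1 = (-1) ^+ (~~ odd k) :> rat by rewrite -signr_odd.
rewrite aA e !scalerA -scalerDl; congr (_ *: _).
by case: (odd k); rewrite /= ?expr0 ?expr1; lra.
Qed.

Definition delta_rows (a b : nat) : pmx :=
  mkseq (fun i => mkseq (fun j => [:: ((i == a) && (j == b))%:Z]) 5) 5.

Lemma delta_pmxev (a b : 'I_5) : delta_mx a b = pmxev 0 5 (delta_rows a b) :>
  'M[rat]_5.
Proof.
apply/matrixP => i j; rewrite !mxE pcoef_mkseq /= mul0r addr0.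
by rewrite -!val_eqE.
Qed.

(** Both sides are 40 times the projection when [odd] holds, and 80 times otherwise: the numerical
    factors reconcile the 20 in [prK] with the multipliers 40 and 16 of [span_coords]. *)
Lemma prK_span (odd : bool) (a b : 'I_5) :
  (if odd then 2 else 4) *: prK odd (delta_mx a b) =
  \sum_(p <- zip (nth [::] (span_coords odd) (5 * a + b)) (span_words odd))
     ((if odd then 1 else 5) * p.1)%:~R *: adw p.2 (top odd).
Proof.
pose Jd := [:: [:: 0; 0; 1; 0; 0]; [:: 0; 0; 0; 1; 1]; [:: 1; 0; 0; 0; 0];
      [:: 0; 1; 0; 0; 1]; [:: 0; 1; 0; 1; 0]] : seq (seq int).
pose Jf := [:: [:: 0; 0; 2; 0; 0]; [:: 0; -1; 0; 1; 1]; [:: 2; 0; 0; 0; 0];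
      [:: 0; 1; 0; -1; 1]; [:: 0; 1; 0; 1; -1]] : seq (seq int).
pose L := pmx_comb 5 [:: ((if odd then 20 else 40), delta_rows a b);
   ((if odd then 10 else - 20), pmx_mul 5 (pmx_mul 5 (const_rows Jd)
       (delta_rows b a)) (const_rows Jf));
   ((if odd then - 8 * (a == b)%:Z else 0), id_rows 5)].
transitivity (pmxev (0 : rat) 5 L).
  rewrite {}/L pmxev_comb !big_cons big_nil addr0 -!pmxM -!imxE -/Jform -/Jdual.
  have -> : pmxev (0 : rat) 5 (id_rows 5) = 1.
    apply/matrixP => i j; rewrite !mxE pcoef_mkseq -val_eqE.
    by case: ifP; rewrite //= mul0r addr0.
  rewrite -!delta_pmxev /prK trmx_delta.
  have -> : \tr (delta_mx a b : 'M[rat]_5) = (a == b)%:R.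
    rewrite /mxtrace (bigD1 a) //= mxE eqxx big1 ?addr0 // => i ia.
    by rewrite mxE (negPf ia).
  move: (Jdual * _ * Jform) (delta_mx a b : 'M[rat]_5) => X D.
  by apply/matrixP => i j; case: odd; case: (a == b); rewrite !mxE /=; ring.
transitivity (pmxev (0 : rat) 5 (pmx_comb 5
    [seq ((if odd then 1 else 5) * p.1, foldr ad_rows (top_rows odd) p.2)
    | p <- zip (nth [::] (span_coords odd) (5 * a + b)) (span_words odd)])).
  apply: pmxev_eq; rewrite {}/L {}/Jd {}/Jf.
  by case: odd; elim/ord5P: a; elim/ord5P: b; vm_compute.
rewrite pmxev_comb big_map; apply: eq_bigr => p _.
by rewrite -adw_pmxev.
Qed.

Lemma ad_bilin i A B : \tr (ad i A * B) = - \tr (A * ad i B).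
Proof.
have trB (C D : 'M[rat]_5) : \tr (C - D) = \tr C - \tr D by rewrite linearB.
rewrite /ad mulrBl mulrBr !trB opprB -!mulrA.
by congr (_ - _); rewrite mxtrace_mulC mulmxE !mulrA.
Qed.

Lemma ad_is_linear i : linear (ad i).
Proof.
move=> c A B; rewrite /ad mulrDr mulrDl -(scalerAr c) -(scalerAl c) scalerBr.
by rewrite opprD addrACA.
Qed.
HB.instance Definition _ i :=
  GRing.isLinear.Build rat 'M[rat]_5 'M[rat]_5 _ (ad i) (ad_is_linear i).

Lemma span_words_ltn odd w : w \in span_words odd -> all (fun i => i < 5)%N w.
Proof. by move: w; apply/allP; case: odd. Qed.

Lemma mem_zip2 (S T : eqType) (s : seq S) (t : seq T) p :
  p \in zip s t -> p.2 \in t.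
Proof.
elim: s t => [|x s IH] [|y t] //=; rewrite !inE.
by case/predU1P => [->|/IH ->]; rewrite ?eqxx ?orbT.
Qed.

Section TopSpan.
Variable W : 'M[rat]_5 -> Prop.
Hypothesis WD : forall c A B, W A -> W B -> W (c *: A + B).
Hypothesis Wad : forall (i : 'I_5) A, W A -> W (ad i A).

Lemma sub_adw w A : all (fun i => i < 5)%N w -> W A -> W (adw w A).
Proof.
elim: w => [|i w IH] //= /andP[i5 w5] wA.
exact: (@Wad (Ordinal i5)) (IH w5 wA).
Qed.

(** By linearity it suffices to treat the [delta_mx a b], whose projections are explicit
    combinations of iterated commutators with [top]. *)
Lemma top_span_prK odd A : W (top odd) -> W (prK odd A).
Proof.
move=> wt; have w0 : W 0 by have := WD (-1) wt wt; rewrite scaleN1r addNr.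
have wZ c B : W B -> W (c *: B) by move=> wB; have := WD c wB w0; rewrite addr0.
have wsum (I : Type) (s : seq I) (F : I -> 'M[rat]_5) :
    (forall i, W (F i)) -> W (\sum_(i <- s) F i).
  move=> wF; elim: s => [|i s IH]; first by rewrite big_nil.
  by rewrite big_cons -[F i]scale1r; apply: WD.
have wpr (a b : 'I_5) : W (prK odd (delta_mx a b)).
  pose c : rat := if odd then 2 else 4.
  have c0 : c != 0 by rewrite /c; case: ifP.
  rewrite -[prK _ _]scale1r -(mulVf c0) -scalerA prK_span; apply: (wZ).
  rewrite big_seq; elim/big_ind: _ => //.
    by move=> B C wB wC; rewrite -[B]scale1r; apply: WD.
  case=> d w; move/mem_zip2 => /= ww.
  by apply: (wZ); apply: sub_adw => //; apply: span_words_ltn ww.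
rewrite (matrix_sum_delta A) linear_sum /=.
apply: (wsum) => i; rewrite linear_sum /=; apply: (wsum) => j.
by rewrite linearZ /=; apply: (wZ).
Qed.

Lemma top_span k A : W (top (odd k)) -> inK k A -> W A.
Proof.
move=> wt kA; rewrite -[A]addr0 -[A]scale1r -(@mulVf _ (20 : rat)) // -scalerA.
rewrite -(prK_id kA); apply: WD; first exact: top_span_prK.
by have := WD (-1) wt wt; rewrite scaleN1r addNr.
Qed.
End TopSpan.

Lemma top_even : top false = Nmx 0.
Proof. by rewrite /top /Nmx imxE. Qed.

Lemma top_odd : top true = Nmx 0 * Nmx 2.
Proof. by rewrite /top /Nmx !imxE pmxM; apply: pmxev_eq; vm_compute. Qed.

Lemma Nmx_comm02 : Nmx 0 * Nmx 2 = Nmx 2 * Nmx 0.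
Proof. by rewrite /Nmx !imxE !pmxM; apply: pmxev_eq; vm_compute. Qed.

Lemma inK_top k : inK k (top (odd k)).
Proof.
have e : (-1) ^+ k.+1 = (-1) ^+ (~~ odd k) :> rat by rewrite -signr_odd.
have a0 := jadj_Nmx (o5 0); have a2 := jadj_Nmx (o5 2).
rewrite /inK e; case: (odd k).
  rewrite expr0 scale1r top_odd jadjM a0 a2 mulrNN -Nmx_comm02; split=> //.
  by rewrite -top_odd /mxtrace big1 // => i _; elim/ord5P: i; rewrite mxE.
rewrite expr1 scaleN1r top_even a0; split=> //.
by rewrite /mxtrace big1 // => i _; elim/ord5P: i; rewrite mxE.
Qed.

(** The projection is self-adjoint for the trace form and fixes A. *)
Lemma trM_prK k A B : inK k A -> \tr (prK (odd k) B * A) = 20 * \tr (B * A).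
Proof.
case=> aA tA.
have e : (-1) ^+ k.+1 = (-1) ^+ (~~ odd k) :> rat by rewrite -signr_odd.
have -> : prK (odd k) B = 10 *: B + (10 * (-1) ^+ ~~ odd k) *: jadj B
    - (4 * (odd k)%:R * \tr B)%:A.
  have es (s : rat) : 5 * s = 10 * s * 2^-1 by field.
  by rewrite /prK /jadj scalerA es.
rewrite mulrBl mulrDl -(scalerAl 10) -(scalerAl (10 * _)) -(scalerAl (4 * _ *
  _)) mul1r.
rewrite [LHS]linearB /= mxtraceD !mxtraceZ.
rewrite tA mulr0 subr0 trM_jadj aA e -(scalerAr ((-1) ^+ ~~ odd k)) mxtraceZ.
by case: (odd k); rewrite ?expr0 ?expr1; lra.
Qed.

Lemma tr_deltaM (a b : 'I_5) (A : 'M[rat]_5) : \tr (delta_mx b a * A) = A a b.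
Proof.
rewrite /mxtrace (bigD1 b) //= big1 => [|i ib].
  rewrite addr0 mxE (bigD1 a) //= big1 => [|j ja]; first by rewrite mxE !eqxx
    mul1r addr0.
  by rewrite mxE (negPf ja) andbF mul0r.
by rewrite mxE big1 // => j _; rewrite mxE (negPf ib) mul0r.
Qed.

Lemma inK_ad k (i : 'I_5) A : inK k A -> inK k (ad i A).
Proof.
apply: (@mcgsub_ad (inK k)); first exact: inKD.
by move=> m B; apply/ConjA_inK/omegaQ_symplectic.
Qed.

(** For N = [Nmx 0] one has (ad N)^2 A = -2 N A N, and the square of ad of a long root vector maps
    so(5) into the line of that vector. The proof reads the needed relations between entries off A^T
    J = - J A. *)
Lemma Nmx0_sandwich k A : ~~ odd k -> inK k A ->
  Nmx 0 * A * Nmx 0 = (2^-1 * \tr (Nmx 0 * A)) *: Nmx 0.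
Proof.
move=> ek [aA _].
have e : (-1) ^+ k.+1 = -1 :> rat by rewrite -signr_odd /= ek expr1.
have JA : A^T *m Jform = - (Jform *m A).
  transitivity (Jform *m jadj A); last by rewrite aA e scaleN1r mulmxN.
  rewrite /jadj -scalemxAr mulmxE !mulrA JJdual -!scalerAl mul1r scalerA mulVf //.
  by rewrite scale1r.
have eq a b := congr1 (fun M : 'M_5 => M a b) JA.
have A20 : A (o5 2) (o5 0) = 0.
  by have := eq (o5 0) (o5 0); rewrite !mxE !sum5 !mxE /=; lra.
have A40 : A (o5 4) (o5 0) = - A (o5 2) (o5 1) - A (o5 2) (o5 3).
  have := eq (o5 0) (o5 1); have := eq (o5 0) (o5 3).
  by rewrite !mxE !sum5 !mxE /=; lra.
have A41 : A (o5 4) (o5 1) = - A (o5 4) (o5 3).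
  have := eq (o5 1) (o5 1); have := eq (o5 3) (o5 3); have := eq (o5 1) (o5 3).
  by rewrite !mxE !sum5 !mxE /=; lra.
have -> : \tr (Nmx 0 * A) = A (o5 4) (o5 0) - A (o5 2) (o5 1) - A (o5 2) (o5 3).
  by rewrite /mxtrace sum5 !mxE !sum5 !mxE /=; ring.
have NA a b : (Nmx 0 * A) a b =
  nth 0 [:: A (o5 4) b; - A (o5 2) b; 0; - A (o5 2) b; 0] a.
  by elim/ord5P: a; rewrite mxE sum5 !mxE /=; ring.
apply/matrixP => a b; rewrite mxE sum5 !NA.
by elim/ord5P: a; elim/ord5P: b; rewrite !mxE /= ?A20 ?A41 ?A40; lra.
Qed.

(** Holds for any matrix of rank one in place of [top true]. *)
Lemma top_odd_sandwich A :
  top true * A * top true = \tr (top true * A) *: top true.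
Proof.
have tE i j : top true i j = - ((i == o5 0) && (j == o5 2))%:R.
  by rewrite /top -imxE mxE; elim/ord5P: i; elim/ord5P: j.
have tA i b : (top true * A) i b = - (i == o5 0)%:R * A (o5 2) b.
  by elim/ord5P: i; rewrite mxE sum5 !tE /=; ring.
apply/matrixP => i j; rewrite [LHS]mxE [RHS]mxE /mxtrace !sum5 !tA !tE.
by elim/ord5P: i; elim/ord5P: j; rewrite /=; ring.
Qed.

(* Some C in W pairs nontrivially with the highest weight vector v = top, for
   otherwise A would be orthogonal to the submodule v generates, which is
   everything.  Then v C v, resp. Nmx 0 C Nmx 0, is a nonzero multiple of v. *)
Lemma inK_irreducible k (W : 'M[rat]_5 -> Prop) A :
  (forall c A B, W A -> W B -> W (c *: A + B)) ->
  (forall m A, W A -> W (ConjA (omegaQ m) A)) ->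
  W A -> inK k A -> A != 0 -> forall B, inK k B -> W B.
Proof.
move=> WD WC wA kA A0 B; apply: (@top_span W) => //; first exact: mcgsub_ad.
have wad := mcgsub_ad WD WC; have wZ := mcgsubZ WD.
have wsw := mcgsub_sandwich WD WC.
have [C [wC kC t0]] : exists C, [/\ W C, inK k C & \tr (top (odd k) * C) != 0].
  apply: contrapT => nC.
  have tC C : W C -> inK k C -> \tr (top (odd k) * C) = 0.
    by move=> wC kC; apply/eqP; apply: contraPT nC => t0 [] //; exists C.
  case/negP: A0; apply/eqP/matrixP => a b; rewrite mxE -tr_deltaM.
  apply: (@mulfI _ (20 : rat)) => //; rewrite mulr0 -(trM_prK _ kA).
  (* The orthogonal complement, for the trace form, of the part of W in the target. It contains
     [top] by [tC] and is stable under [ad] by invariance of the trace form, so it contains the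
     projection of every elementary matrix; pairing these with A shows that its entries vanish. *)
  pose W' B := forall C, W C -> inK k C -> \tr (B * C) = 0.
  suff : W' (prK (odd k) (delta_mx b a)) by apply.
  apply: (@top_span_prK W') => [c D E wD wE C wC kC|i D wD C wC kC|]; last
    exact: tC.
    by rewrite mulrDl -(scalerAl c) mxtraceD mxtraceZ wD // wE // mulr0 addr0.
  by rewrite ad_bilin wD ?oppr0 //; [exact: wad | exact: inK_ad].
have [ok|ek] := boolP (odd k).
  rewrite ok in t0 *.
  have -> : top true = (\tr (top true * C))^-1 *: (top true * C * top true).
    rewrite -[LHS]scale1r -(mulVf t0) -scalerA; congr (_ *: _).
    exact/esym/top_odd_sandwich.
  (* As N_0 and N_2 commute, [top] C [top] consists of two nested sandwiches, by N_2 inside and N_0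
     outside. *)
  apply: (wZ); rewrite {2}top_odd top_odd {2}Nmx_comm02.
  have -> : Nmx 0 * Nmx 2 * C * (Nmx 2 * Nmx 0) = Nmx 0 * (Nmx 2 * C * Nmx 2) *
    Nmx 0.
    by rewrite !mulrA.
  by apply: (wsw (o5 0)); apply: (wsw (o5 2)).
rewrite (negPf ek) top_even in t0 *.
have -> : Nmx 0 = (2^-1 * \tr (Nmx 0 * C))^-1 *: (Nmx 0 * C * Nmx 0).
  by rewrite (Nmx0_sandwich ek kC) scalerA mulVf ?scale1r // mulf_neq0.
by apply: (wZ); apply: (wsw (o5 0)).
Qed.

(** * The associated graded of the filtration *)

Lemma pev_hvar p n : pev hvar p n = (nth 0 p n)%:~R.
Proof.
elim: p n => [|a p IH] n /=; first by rewrite nth_nil.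
have -> : (a%:~R + hvar * pev hvar p) n = (a%:~R : fps) n + (hvar * pev hvar p)
  n by [].
rewrite hvarM; case: n => [|n]; rewrite ?addr0.
  by have /= := rmorph_int fps_at0 a.
rewrite IH; have -> : (a%:~R : fps) n.+1 = 0; last by rewrite add0r.
have nat0 (m : nat) : (m%:R : fps) n.+1 = 0.
  by elim: m => // m IHm; rewrite -natr1 -[LHS]/((m%:R : fps) n.+1 + 0) IHm addr0.
case: a => m; first exact: nat0.
by rewrite NegzE intrN -[LHS]/(- ((m.+1%:R : fps) n.+1)) nat0 oppr0.
Qed.

Lemma cmx_pmxev_hvar n r (i j : 'I_5) :
  cmx n (pmxev hvar 5 r) i j = (nth 0 (pcoef r i j) n)%:~R.
Proof. by rewrite !mxE /fcoef pev_hvar. Qed.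

(* t^-2 (a + b t^5) = a e^(-2h) - b e^(3h) = (a - b) - (2 a + 3 b) h + ... *)
Definition jet_rows (i : nat) : pmx :=
  mkseq (fun a => mkseq (fun b => let p := pcoef (jrows i) a b in
    [:: nth 0 p 0 - nth 0 p 1; - 2 * nth 0 p 0 - 3 * nth 0 p 1]) 5) 5.

Lemma phi_zeta_jet (i : 'I_5) : hfil 2 (phi (zeta i) - pmxev hvar 5 (jet_rows i)).
Proof.
apply/hfilP => n n2; rewrite cmxB; apply/eqP; rewrite subr_eq0; apply/eqP.
apply/matrixP => a b; rewrite cmx_pmxev_hvar pcoef_mkseq mxE phi_zetaE.
rewrite /jpair; move: (nth 0 _ _) (nth 0 _ _) => x y.
case: n n2 => [|[|]] // _ /=.
  rewrite [LHS](rmorphB fps_at0) !rmorphM !rmorph_int /= /fps_at0 !expfps_at0.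
  by rewrite !mulr1 intrB.
have e (z : int) c : fcoef 1 (z%:~R * expfps c) = z%:~R * c.
  have z1 : (z%:~R : fps) 1%N = 0.
    by have := pev_hvar [:: z] 1; rewrite /= mulr0 addr0.
  rewrite /fcoef fpsM1 z1 mul0r addr0 expfps_at1; congr (_ * _).
  exact: (rmorph_int fps_at0).
by rewrite raddfB /= !e intrB !intrM; ring.
Qed.

(** By the chain relation, (zeta_1 zeta_2)^6 is the twist along the boundary of a neighbourhood of
    the union of C_1 and C_2, a separating curve of genus 1. *)
Definition sep_twist : mcg :=
  let z := (zeta (o5 0) * zeta (o5 1))%g in (z * z * z * z * z * z)%g.

Lemma sep_twist_torelli : torelli sep_twist.
Proof.
rewrite /torelli /sep_twist !omegaM !omega_zeta.
have t i : transvection (chain_class i) = pmxev (0 : int) 4 (tv_rows 1 i) by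
  exact: twistE.
by rewrite !t !tevM -tev1; apply: pmxev_eq; vm_compute.
Qed.

Definition jet_mul (r s : pmx) : pmx := let m := pmx_mul 5 r s in
  mkseq (fun i => mkseq (fun j => take 2 (pcoef m i j)) 5) 5.

Lemma jet_mulP A B r s :
  hfil 2 (A - pmxev hvar 5 r) -> hfil 2 (B - pmxev hvar 5 s) ->
  hfil 2 (A * B - pmxev hvar 5 (jet_mul r s)).
Proof.
move=> hA hB; rewrite -[X in hfil 2 X](subrKA (pmxev hvar 5 r * pmxev hvar 5 s)).
apply: hfilD; first exact: hfil_congM.
apply/hfilP => n n2; rewrite cmxB pmxM; apply/matrixP => i j.
have e : pcoef (jet_mul r s) i j = take 2 (pcoef (pmx_mul 5 r s) i j).
  exact: pcoef_mkseq.
by rewrite mxE [X in _ + X]mxE !cmx_pmxev_hvar e nth_take // subrr mxE.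
Qed.

(** The jet [r] is bound existentially so that its defining equation can be rewritten just before
    [vm_compute]. *)
Lemma sep_twist_jet : exists2 r : pmx,
  hfil 2 (phi sep_twist - pmxev hvar 5 r) &
  r = let s := jet_mul (jet_rows 0) (jet_rows 1) in
      jet_mul (jet_mul (jet_mul (jet_mul (jet_mul s s) s) s) s) s.
Proof.
eexists; last reflexivity; rewrite /= /sep_twist 5!phiM.
have hs : hfil 2 (phi (zeta (o5 0) * zeta (o5 1))%g
    - pmxev hvar 5 (jet_mul (jet_rows 0) (jet_rows 1))).
  by rewrite phiM; apply: jet_mulP; apply: phi_zeta_jet.
by do 5![apply: (jet_mulP _ hs)].
Qed.

Lemma sep_twist_fil : jones_fil 1 sep_twist.
Proof.
split; first exact: sep_twist_torelli.
have [r /hfilP/(_ 0%N isT) e er] := sep_twist_jet.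
apply/hfilP => -[|//] _; move/eqP: e; rewrite !cmxB cmx0_1 subr_eq0 => /eqP->.
have /allP r0 : all (fun i => all (fun j =>
    nth 0 (pcoef r i j) 0 == (i == j)%:Z) (iota 0 5)) (iota 0 5).
  by rewrite er; vm_compute.
apply/matrixP => i j; rewrite mxE cmx_pmxev_hvar !mxE.
have inI (k : 'I_5) : (k : nat) \in iota 0 5 by rewrite mem_iota /= add0n.
have /allP/(_ j (inI j))/eqP -> := r0 i (inI i).
by apply/eqP; rewrite subr_eq0.
Qed.

Lemma lead_sep_twist : lead 1 sep_twist != 0.
Proof.
have [r /hfilP/(_ 1%N isT) e er] := sep_twist_jet.
apply/eqP => /matrixP/(_ (o5 0) (o5 0)).
move/eqP: e; rewrite /lead !cmxB subr_eq0 => /eqP->.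
rewrite mxE cmx_pmxev_hvar [in RHS]mxE.
have -> : nth 0 (pcoef r (o5 0) (o5 0)) 1 = 6 by rewrite er; vm_compute.
have -> : (- cmx 1 1) (o5 0) (o5 0) = 0 :> rat by rewrite !mxE oppr0.
by [].
Qed.

Lemma lead_BE k x : jones_fil k x -> (jones_fil k.+1 x <-> lead k x = 0).
Proof. by move=> fx; rewrite jones_filS; split=> [[]|]. Qed.

Definition gr_lead n : grF n.+1 -> 'M[rat]_5 := quotQ_lift (lead n.+1).

Lemma gr_lead_is_linear n : linear (@gr_lead n).
Proof.
exact: (quotQ_lift_is_linear (fun x y => @leadM n.+1 x y isT) (@lead_BE n.+1)).
Qed.
HB.instance Definition _ n :=
  GRing.isLinear.Build rat (grF n.+1) 'M[rat]_5 _ (@gr_lead n)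
    (@gr_lead_is_linear n).

Lemma gr_lead_tens n (x : memb (jones_fil n.+1)) c :
  gr_lead (tens _ x c) = c *: lead n.+1 (val x).
Proof.
exact: (quotQ_lift_tens (fun x y => @leadM n.+1 x y isT) (@lead_BE n.+1)).
Qed.

Lemma gr_lead_inj n : injective (@gr_lead n).
Proof.
exact: (quotQ_lift_inj (jones_fil1 _) (@jones_filM _) (@jones_filV _)
  (fun x y => @leadM n.+1 x y isT) (@lead_BE n.+1)).
Qed.

Lemma grF_tensP n (v : grF n.+1) : exists c x, v = tens _ x c.
Proof. exact: (quotQ_tensP (jones_fil1 _) (@jones_filM _) (@jones_filV _)). Qed.

Lemma gr_lead_inK n v : inK n.+1 (@gr_lead n v).
Proof.
have [c [x ->]] := grF_tensP v; rewrite gr_lead_tens -[c *: _]addr0.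
have k0 : inK n.+1 (lead n.+1 (val x)) by apply: lead_inK (membP x).
by apply: inKD => //; have := inKD (-1) k0 k0; rewrite scaleN1r addNr.
Qed.

Lemma gr_lead_conj n m (v : grF n.+1) :
  exists w, @gr_lead n w = ConjA (omegaQ m) (@gr_lead n v).
Proof.
have [c [x ->]] := grF_tensP v.
exists (tens _ (mkmemb (jones_fil_conj m (membP x))) c).
rewrite !gr_lead_tens linearZ /=; congr (_ *: _).
by apply: (lead_ConjA m (membP x)).
Qed.

Lemma gr_lead_surj_of_neq0 n x : jones_fil n.+1 x -> lead n.+1 x != 0 ->
  forall A, inK n.+1 A -> exists v, @gr_lead n v = A.
Proof.
move=> fx lx0; apply: (@inK_irreducible _ _ (lead n.+1 x)) => //.
- by move=> c _ _ [v <-] [w <-]; exists (c *: v + w); rewrite linearP.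
- by move=> m _ [v <-]; apply: gr_lead_conj.
- by exists (tens _ (mkmemb fx) 1); rewrite gr_lead_tens scale1r.
- exact: lead_inK.
Qed.

Lemma gr_lead_surj n A : inK n.+1 A -> exists v, @gr_lead n v = A.
Proof.
elim: n A => [|n IH] A.
  exact: gr_lead_surj_of_neq0 sep_twist_fil lead_sep_twist A.
have [v ev] := @gr_lead_surj_of_neq0 0 _ sep_twist_fil lead_sep_twist _ (inK_top 1).
(* An element of the target of order n + 1 that does not commute with [top true] = -E_02: the skew
   N_1 if n + 1 is even, the opposite symmetric matrix E_20 if n + 1 is odd. *)
have [B kB AB] : exists2 B, inK n.+1 B & top true * B != B * top true.
  have tE i j : top true i j = - ((i == o5 0) && (j == o5 2))%:R.
    by rewrite /top -imxE mxE; elim/ord5P: i; elim/ord5P: j.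
  have [on|en] := boolP (odd n).
    have kN : inK n.+1 (Nmx (o5 1)).
      split; last by rewrite /mxtrace big1 // => i _; elim/ord5P: i; rewrite mxE.
      by rewrite jadj_Nmx -signr_odd /= on expr1 scaleN1r.
    exists (Nmx (o5 1)) => //; apply/eqP => /matrixP/(_ (o5 0) (o5 1)).
    by rewrite !mxE !sum5 !tE !mxE /=; lra.
  exists (delta_mx (o5 2) (o5 0)).
    split; last by rewrite /mxtrace big1 // => i _; elim/ord5P: i; rewrite mxE.
    rewrite -signr_odd /= (negPf en) expr0 scale1r /jadj trmx_delta.
    apply/matrixP => i j; rewrite mxE mxE sum5 !mxE !sum5 !mxE.
    by elim/ord5P: i; elim/ord5P: j; rewrite /=; lra.
  apply/eqP => /matrixP/(_ (o5 0) (o5 0)).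
  by rewrite !mxE !sum5 !tE !mxE /=; lra.
have [w ew] := IH B kB.
(* As all elements are pure tensors, [top true] = c L_1(x) and B = d L_{n+1}(y), so L_1(x) and
   L_{n+1}(y) do not commute either. *)
have [c [x vE]] := grF_tensP v; have [d [y wE]] := grF_tensP w.
move: ev ew; rewrite vE wE !gr_lead_tens => ev ew.
apply: (gr_lead_surj_of_neq0 (jones_fil_comm (membP x) (membP y))).
rewrite (lead_comm _ _ (membP x) (membP y)) // subr_eq0; apply: contraNneq AB => e.
by rewrite -ev -ew -!(scalerAl c) -!(scalerAr d) e -!(scalerAl d) -!(scalerAr
  c) !scalerA mulrC.
Qed.

(** * Highest weight vectors *)

Local Notation c1 := (delta_mx (o4 0) 0 : 'cV[rat]_4).
Local Notation c2 := (delta_mx (o4 1) 0 : 'cV[rat]_4).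
Local Notation u0 := (delta_mx (o5 0) 0 : 'cV[rat]_5).

Definition long_root (s : rat) : 'M[rat]_4 := 1 + s *: (c1 *m (c1^T *m Om)).

Lemma long_root1 : long_root 1 = omegaQ (zeta (o5 0)).
Proof.
have ec : map_mx intr (chain_class (o5 0)) = c1.
  by apply/matrixP => i j; rewrite !mxE ord1; elim/ord4P: i.
have ecT : map_mx intr (chain_class (o5 0))^T = c1^T.
  by rewrite -ec; apply/matrixP => i j; rewrite !mxE.
have eJ : map_mx intr (symJ int) = Om.
  by apply/matrixP => i j; rewrite !mxE rmorphB /= !rmorph_nat.
rewrite /omegaQ omega_zeta /long_root scale1r -ecT -eJ -[X in X *m (_ *m _)]ec.
by rewrite /transvection map_mxD map_mx1 !map_mxM.
Qed.

(** With D = c_1 c_1^T Om, the quadratic term D X D^T vanishes because it contains an alternating 1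
    x 1 matrix. The action is thus affine in s, and its slope is read off at s = 1, where
    [long_root] is the first twist. *)
Lemma ext2_long_root s : ext2 (long_root s) = 1 + s *: Nmx 0.
Proof.
apply: mulmx_cV_inj => u; set D := c1 *m (c1^T *m Om).
have sX : (skmx u)^T = - skmx u by case: (skmx_primitive u).
have DXD : D *m skmx u *m D^T = 0.
  rewrite /D; move: (c1^T *m Om) => r; pose z := r *m skmx u *m r^T.
  have zT : z^T = - z by rewrite /z !trmx_mul trmxK sX mulNmx mulmxN mulmxA.
  have z0 : z = 0.
    apply/matrixP => i j; have /matrixP/(_ i j) := zT; rewrite !mxE !ord1.
    by move: (z 0 0) => ?; lra.
  by rewrite trmx_mul mulmxA -(mulmxA c1) -(mulmxA c1) -/z z0 mulmx0 mul0mx.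
have act r : ext2 (long_root r) *m u
    = u + r *: skcoord (D *m skmx u + skmx u *m D^T).
  rewrite ext2_mul /long_root -/D linearD /= trmx1 linearZ /= mulmxDl mul1mx.
  rewrite mulmxDr mulmx1 -scalemxAr mulmxDl -!scalemxAl DXD !scaler0 addr0.
  by rewrite -addrA -scalerDr linearD linearZ /= skmxK.
have := act 1; rewrite long_root1 ext2_zeta scale1r mulmxDl mul1mx => /addrI Nu.
by rewrite act -Nu mulmxDl mul1mx scalemxAl.
Qed.

Lemma symplectic_dual g c x : is_symplectic g -> g *m c = x *: c ->
  c^T *m Om = x *: (c^T *m Om *m g) :> 'rV_4.
Proof.
move=> /eqP sg gc; rewrite -{1}sg !mulmxA -trmx_mul gc linearZ /=.
by rewrite -!scalemxAl.
Qed.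

(** If c_1 is an eigenvector of g, then g conjugates [long_root 1] to [long_root (x ^+ 2)]; applying
    [ext2] and comparing the nilpotent parts gives the claim. *)
Lemma ConjA_top_even g x : is_symplectic g -> g *m c1 = x *: c1 ->
  ConjA g (top false) = x ^+ 2 *: top false.
Proof.
move=> sg gc; rewrite top_even /ConjA.
have gT : g * long_root 1 = long_root (x ^+ 2) * g.
  rewrite /long_root mulrDr mulrDl mulr1 mul1r scale1r; congr (_ + _).
  rewrite -[g * _]/(g *m _) -[_ * g]/(_ *m g) (mulmxA g) gc -!scalemxAl
    {1}(symplectic_dual sg gc).
  by rewrite -scalemxAr scalerA expr2 -!mulmxA.
have := congr1 ext2 gT.
rewrite !ext2M //; last by rewrite long_root1 omegaQ_symplectic.
rewrite !ext2_long_root scale1r mulrDr mulrDl mulr1 mul1r.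
move/addrI => ->.
by rewrite -!(scalerAl (x ^+ 2)) -mulrA ext2_jadj // mulr1.
Qed.

(** Here [top true] is a multiple of u u^T J, where u corresponds to the bivector of c_1 and c_2.
    This bivector is multiplied by x y, the term in b dropping out. *)
Lemma ConjA_top_odd g x y b : is_symplectic g -> g *m c1 = x *: c1 ->
  g *m c2 = y *: c2 + b *: c1 ->
  ConjA g (top true) = (x * y) ^+ 2 *: top true.
Proof.
move=> sg g1 g2.
have tE : top true = (- 2^-1) *: (u0 *m u0^T *m Jform).
  apply/matrixP => i j; rewrite /top -imxE !mxE sum5 trmx_delta !mxE !big_ord1 !mxE.
  by elim/ord5P: i; elim/ord5P: j; rewrite /=; lra.
have sk0 : skmx u0 = 2 *: (c1 *m c2^T - c2 *m c1^T).
  apply/matrixP => i j; rewrite !trmx_delta !mxE !big_ord1 !mxE.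
  by elim/ord4P: i; elim/ord4P: j; rewrite /=; lra.
have Ru : ext2 g *m u0 = (x * y) *: u0.
  rewrite ext2_mul -[in RHS](skmxK u0) -linearZ /=; congr skcoord.
  rewrite sk0 -!scalemxAr -!scalemxAl [RHS]scalerA [x * y * 2]mulrC -[RHS]scalerA.
  congr (_ *: _).
  rewrite mulmxBr mulmxBl !mulmxA g1 g2 -!mulmxA -!trmx_mul g1 g2.
  by apply/matrixP => i j; rewrite !(mxE, big_ord1); ring.
rewrite /ConjA tE -(scalerAr (- 2^-1)) -(scalerAl (- 2^-1)) scalerA mulrC
  -scalerA; congr (_ *: _).
rewrite /jadj -scalerAr.
have -> : ext2 g * (u0 *m u0^T *m Jform) * (Jdual * (ext2 g)^T * Jform)
   = 2 *: (ext2 g *m u0 *m (ext2 g *m u0)^T *m Jform).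
  rewrite trmx_mul -!mulmxE -!mulmxA (mulmxA Jform) (JJdual : _ *m _ = _).
  by rewrite -!scalemxAl mul1mx -!scalemxAr.
rewrite Ru [(_ *: u0)^T]linearZ /= -!scalemxAl -scalemxAr -!scalemxAl !scalerA.
by congr (_ *: _); field.
Qed.

Lemma torus_symplectic x y : x != 0 -> y != 0 -> is_symplectic (torus x y).
Proof.
move=> x0 y0; apply/eqP/matrixP => i j; rewrite !mxE sum4 !mxE !sum4 !mxE.
by elim/ord4P: i; elim/ord4P: j; rewrite /=; field; rewrite ?x0 ?y0.
Qed.

Lemma ConjA_torus_top (odd : bool) x y : x != 0 -> y != 0 ->
  ConjA (torus x y) (top odd) =
  (if odd then (x * y) ^+ 2 else x ^+ 2) *: top odd.
Proof.
move=> x0 y0; have st := torus_symplectic x0 y0.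
have t1 : torus x y *m c1 = x *: c1.
  rewrite -colE; apply/matrixP => i j; rewrite !mxE ord1.
  by elim/ord4P: i; rewrite /= ?mulr0 ?mulr1.
have t2 : torus x y *m c2 = y *: c2 + 0 *: c1.
  rewrite -colE; apply/matrixP => i j; rewrite !mxE ord1.
  by elim/ord4P: i; rewrite /= ?mul0r ?addr0 ?mulr0 ?mulr1.
by case: odd; [apply: ConjA_top_odd st t1 t2 | apply: ConjA_top_even].
Qed.

Lemma ConjA_unipotent_top odd g : pos_unipotent g -> ConjA g (top odd) = top odd.
Proof.
move=> [sg gu].
have g1 : g *m c1 = 1 *: c1.
  by rewrite -colE; apply/matrixP => i j; rewrite !mxE ord1 andbT gu // mul1r.
have g2 : g *m c2 = 1 *: c2 + g (o4 0) (o4 1) *: c1.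
  rewrite -colE; apply/matrixP => i j; rewrite !mxE ord1 !andbT mul1r.
  have [->|i0] := eqVneq i (o4 0); first by rewrite mulr1 add0r.
  by rewrite mulr0 addr0 gu // lt0n.
by case: odd; rewrite ?(ConjA_top_odd sg g1 g2) ?(ConjA_top_even sg g1)
  ?mulr1 expr1n scale1r.
Qed.

(** * Polynomial dependence on the group element *)

Definition polyfun (f : 'M[rat]_4 -> rat) : Prop :=
  exists P : {mpoly rat[4 * 4]}, forall g, f g = P.@[fun l => mxvec g 0 l].

Lemma polyfun_cst c : polyfun (fun=> c).
Proof. by exists c%:MP_[4 * 4] => g; rewrite mevalC. Qed.

Lemma polyfun_coord i j : polyfun (fun g => g i j).
Proof. by exists 'X_(mxvec_index i j) => g; rewrite mevalXU mxvecE. Qed.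

Lemma polyfunM f f' : polyfun f -> polyfun f' -> polyfun (fun g => f g * f' g).
Proof. by move=> [P e] [P' e']; exists (P * P') => g; rewrite mevalM e e'. Qed.

Lemma polyfun_sum (I : finType) (F : I -> 'M[rat]_4 -> rat) :
  (forall i, polyfun (F i)) -> polyfun (fun g => \sum_i F i g).
Proof.
move=> pF; have [P e] := choice pF; exists (\sum_i P i) => g.
by rewrite raddf_sum; apply: eq_bigr => i _; apply: e.
Qed.

Lemma polyfun_ext f f' : f =1 f' -> polyfun f -> polyfun f'.
Proof. by move=> ff [P e]; exists P => g; rewrite -ff. Qed.

Definition polymx m n (F : 'M[rat]_4 -> 'M[rat]_(m, n)) : Prop :=
  forall i j, polyfun (fun g => F g i j).

Lemma polymx_cst m n (A : 'M[rat]_(m, n)) : polymx (fun=> A).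
Proof. by move=> i j; apply: polyfun_cst. Qed.

Lemma polymxM m n p (F : 'M[rat]_4 -> 'M[rat]_(m, n))
    (F' : 'M[rat]_4 -> 'M[rat]_(n, p)) :
  polymx F -> polymx F' -> polymx (fun g => F g *m F' g).
Proof.
move=> pF pF' i j.
apply: (@polyfun_ext (fun g => \sum_k F g i k * F' g k j)) => [g|].
  by rewrite mxE.
by apply: polyfun_sum => k; apply: polyfunM.
Qed.

Lemma polymx_tr m n (F : 'M[rat]_4 -> 'M[rat]_(m, n)) :
  polymx F -> polymx (fun g => (F g)^T).
Proof.
by move=> pF i j; apply: (@polyfun_ext (fun g => F g j i)) => [g|//]; rewrite mxE.
Qed.

Lemma polymx_linear m n p q (L : {linear 'M[rat]_(m, n) -> 'M[rat]_(p, q)}) F :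
  polymx F -> polymx (fun g => L (F g)).
Proof.
move=> pF a b; apply: (@polyfun_ext (fun g =>
    \sum_i \sum_j F g i j * L (delta_mx i j) a b)) => [g|].
  rewrite [in RHS](matrix_sum_delta (F g)) linear_sum summxE.
  apply: eq_bigr => i _; rewrite linear_sum summxE; apply: eq_bigr => j _.
  by rewrite linearZ mxE.
apply: polyfun_sum => i; apply: polyfun_sum => j; apply: polyfunM => //.
exact: polyfun_cst.
Qed.

Lemma polymx_ext2 : polymx ext2.
Proof.
move=> a b; apply: (@polyfun_ext (fun g =>
  skcoord (g *m skmx (delta_mx b 0) *m g^T) a 0)) => [g|]; first by rewrite
    [RHS]mxE.
have pid : polymx (fun g : 'M[rat]_4 => g) by move=> i j; apply: polyfun_coord.
apply: (@polymx_linear _ _ _ _ skcoord).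
apply: polymxM (polymx_tr pid); apply: polymxM => //; exact: polymx_cst.
Qed.

Lemma polymx_ConjA A : polymx (ConjA^~ A).
Proof.
apply: polymxM; first by apply: polymxM; [apply: polymx_ext2 | apply: polymx_cst].
by apply: (@polymx_linear _ _ _ _ jadj); apply: polymx_ext2.
Qed.

(** * The action of Sp(4,Q) *)

Lemma top_neq0 odd : top odd <> 0.
Proof.
rewrite /top -imxE => /matrixP e; case: odd e => e.
  by have := e (o5 0) (o5 2); rewrite !mxE.
by have := e (o5 0) (o5 4); rewrite !mxE.
Qed.

Definition inK_defect (k : nat) (A : 'M[rat]_5) : 'M[rat]_5 :=
  jadj A - (-1) ^+ k.+1 *: A.
Definition trace_mx (A : 'M[rat]_5) : 'M[rat]_5 := (\tr A)%:A.

Lemma inK_defect_is_linear k : linear (inK_defect k).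
Proof.
move=> c A B; rewrite /inK_defect linearP /= scalerDr opprD addrACA scalerBr.
by rewrite !scalerA [c * (-1) ^+ _]mulrC.
Qed.
HB.instance Definition _ k := GRing.isLinear.Build rat 'M[rat]_5 'M[rat]_5 _
  (inK_defect k) (inK_defect_is_linear k).

Lemma trace_mx_is_linear : linear trace_mx.
Proof.
by move=> c A B; rewrite /trace_mx mxtraceD mxtraceZ scalerDl -scalerA.
Qed.
HB.instance Definition _ := GRing.isLinear.Build rat 'M[rat]_5 'M[rat]_5 _
  trace_mx trace_mx_is_linear.

(** The target as a subspace, whose basis serves for [algebraic_action]. *)
Definition inK_space (k : nat) : {vspace 'M[rat]_5} :=
  (lker (linfun (inK_defect k)) :&: lker (linfun trace_mx))%VS.

Lemma inK_spaceP k A : reflect (inK k A) (A \in inK_space k).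
Proof.
rewrite memv_cap !memv_ker !lfunE /= subr_eq0 /trace_mx scaler_eq0 oner_eq0 orbF.
by apply: (iffP andP) => [[/eqP ? /eqP ?]|[/eqP ? /eqP ?]].
Qed.

Section Action.
Variable n : nat.
Local Notation L := (@gr_lead n).

(** Transport of [ConjA] through L. By surjectivity and stability of the target, the default value 0
    can only occur for g that is not symplectic. *)
Definition gr_act (g : 'M[rat]_4) (v : grF n.+1) : grF n.+1 :=
  if pselect (exists w, L w = ConjA g (L v)) is left e then sval (cid e) else 0.

Lemma gr_actE g v : is_symplectic g -> L (gr_act g v) = ConjA g (L v).
Proof.
move=> sg; rewrite /gr_act; case: pselect => [e|[]]; first exact: svalP (cid e).
exact/gr_lead_surj/ConjA_inK/gr_lead_inK.
Qed.

Lemma gr_act_sp : sp_action gr_act.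
Proof.
have s1 : is_symplectic (1 : 'M[rat]_4).
  by rewrite /is_symplectic trmx1 mul1mx mulmx1.
split=> [g sg c u v|v|g h v sg sh]; apply: gr_lead_inj.
- by rewrite gr_actE // !linearP /= !gr_actE.
- by rewrite gr_actE // ConjA_1.
- by rewrite !gr_actE ?ConjA_M //; apply: symplecticM.
Qed.

Lemma gr_act_algebraic : algebraic_action gr_act.
Proof.
set U := inK_space n.+1; pose X := vbasis U.
have Xin i : X`_i \in U.
  case: (ltnP i (\dim U)) => iU; last by rewrite nth_default ?mem0v // size_tuple.
  by apply/vbasis_mem/mem_nth; rewrite size_tuple.
(* The basis of the graded piece that L maps to the basis [X] of the target. *)
have [e eE] := choice (fun i : 'I_(\dim U) => gr_lead_surj (inK_spaceP _ _ (Xin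
  i))).
have inU v : L v \in U by apply/inK_spaceP/gr_lead_inK.
have LE v : v = \sum_i coord X i (L v) *: e i.
  apply: gr_lead_inj; rewrite linear_sum /= [LHS](coord_vbasis (inU v)).
  by apply: eq_bigr => i _; rewrite linearZ /= eE.
have pP (ij : 'I_(\dim U) * 'I_(\dim U)) :
    polyfun (fun g => coord X ij.1 (ConjA g X`_ij.2)).
  apply: (@polyfun_ext (fun g => \sum_a \sum_b ConjA g X`_ij.2 a b
      * coord X ij.1 (delta_mx a b))) => [g|].
    rewrite [in RHS](matrix_sum_delta (ConjA g _)) linear_sum.
    apply: eq_bigr => a _; rewrite linear_sum; apply: eq_bigr => b _.
    by rewrite linearZ.
  apply: polyfun_sum => a; apply: polyfun_sum => b.
  by apply: polyfunM; [apply: polymx_ConjA | apply: polyfun_cst].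
have [P PE] := choice pP.
exists (\dim U), e, (fun i j => P (i, j)); split=> [v|g j sg].
  exists (\row_i coord X i (L v)); split.
    by rewrite {1}[v]LE; apply: eq_bigr => i _; rewrite mxE.
  move=> c ->; apply/rowP => i; rewrite mxE.
  have -> : L (\sum_j c 0 j *: e j) = \sum_j c 0 j *: X`_j.
    by rewrite linear_sum; apply: eq_bigr => j _; rewrite linearZ /= eE.
  by rewrite coord_sum_free // (basis_free (vbasisP U)).
rewrite [LHS]LE; apply: eq_bigr => i _; congr (_ *: _).
by rewrite -(PE (i, j)) gr_actE // eE.
Qed.

Lemma gr_act_mcg (m : mcg) (x y : memb (jones_fil n.+1)) (c : rat) :
  val y = (m * val x * m^-1)%g ->
  gr_act (map_mx intr (omega m)) (tens _ x c) = tens _ y c.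
Proof.
move=> e; apply: gr_lead_inj; rewrite gr_actE; last exact: omegaQ_symplectic.
rewrite !gr_lead_tens e (lead_ConjA m (membP x)) -[map_mx _ _]/(omegaQ m).
exact: linearZ.
Qed.

Lemma gr_act_grF : grF_action gr_act.
Proof.
split; last exact: gr_act_mcg.
by split; [exact: gr_act_sp | exact: gr_act_algebraic].
Qed.

(** An Sp(4,Q)-submodule has an image under L that is stable under the mapping class group, to which
    [inK_irreducible] applies. *)
Lemma gr_act_irreducible : irreducible_rep gr_act.
Proof.
have [v0 v0E] := gr_lead_surj (inK_top n.+1).
split.
  exists v0 => v00; have := v0E; rewrite v00 linear0 => /esym.
  exact: top_neq0.
move=> W [W0 WD WC]; have [Wz|/existsNP[v]] := pselect (forall v, W v -> v = 0).
  by left.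
move=> /not_implyP[Wv v0']; right => w.
have [] : exists2 w', W w' & L w' = L w; last first.
  by move=> w' Ww' /gr_lead_inj <-.
apply: (@inK_irreducible n.+1 (fun A => exists2 w', W w' & L w' = A) (L v)).
- by move=> c _ _ [u Wu <-] [u' Wu' <-]; exists (c *: u + u'); rewrite ?linearP
  //; apply: WD.
- move=> m _ [u Wu <-]; exists (gr_act (omegaQ m) u).
    by apply: WC => //; apply: omegaQ_symplectic.
  exact/gr_actE/omegaQ_symplectic.
- by exists v.
- exact: gr_lead_inK.
- by apply/eqP => Lv; apply: v0'; apply: gr_lead_inj; rewrite Lv linear0.
- exact: gr_lead_inK.
Qed.

Lemma gr_act_Gamma a b :
  (forall x y : rat, (if odd n.+1 then (x * y) ^+ 2 else x ^+ 2)
     = x ^+ (a + b) * y ^+ b) ->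
  is_Gamma a b gr_act.
Proof.
move=> ab; have [v0 v0E] := gr_lead_surj (inK_top n.+1).
split; [by case: gr_act_grF | exact: gr_act_irreducible |].
exists v0; split.
- by move=> v00; move: v0E; rewrite v00 linear0 => /esym; apply: top_neq0.
- move=> x y x0 y0; apply: gr_lead_inj.
  rewrite gr_actE ?torus_symplectic // v0E ConjA_torus_top // ab.
  by rewrite linearZ /= v0E.
- move=> g gu; apply: gr_lead_inj.
  by rewrite gr_actE ?v0E ?ConjA_unipotent_top //; case: gu.
Qed.

End Action.

Theorem theorem1p3 (k : nat) (hk : (2 <= k)%N) :
  exists act : 'M[rat]_4 -> grF k -> grF k,
    grF_action act /\
    (~~ odd k -> contains_Gamma 2 0 act) /\
    (odd k -> contains_Gamma 0 2 act).
Proof.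
case: k hk => // n _; exists (@gr_act n); split; first exact: gr_act_grF.
have sub a b : is_Gamma a b (@gr_act n) -> contains_Gamma a b (@gr_act n).
  by move=> G; exists (grF n.+1), (@gr_act n), idfun; split=> //; apply: inj_id.
split=> [en|on]; apply/sub/gr_act_Gamma => x y.
  by rewrite (negPf en) expr0 mulr1.
by rewrite on exprMn.
Qed.
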